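(* Let $M$ be a smooth manifold of dimension $\geq 2$, let $M_{\mathrm{sing}}\subset M$ be a closed subset with dense complement, and let $\omega\in\Omega^2(M\setminus M_{\mathrm{sing}})$ be a closed 2-form. Let $\wedge^\bullet T^*M$ be equipped with the fiberwise norm $\|\cdot\|$ of a smooth fiberwise metric, and let $f:=\|e^{-\omega}\|^{-1}$, which is a smooth function on $M\setminus M_{\mathrm{sing}}$. A singularity of $\omega$ at $m\in M_{\mathrm{sing}}$ is not removable if any one of the following obstructions applies: (i) $f$ does not extend continuously to $m$. (ii) $f$ extends continuously to $m$ but (the extension satisfies) $f(m)\neq 0$. (iii) The singularity of $\omega$ at $m$ is bounded.
   Context: Singularity: $\omega\in\Omega^2(M\setminus M_{\mathrm{sing}})$ has a singularity at $m\in M_{\mathrm{sing}}$ if it does not have a smooth extension to a neighborhood of $m$, where a smooth extension to a neighborhood $U$ of $m$ is a 2-form $\bar\omega\in\Omega^2((M\setminus M_{\mathrm{sing}})\cup U)$ restricting to $\omega$ on $M\setminus M_{\mathrm{sing}}$. The singularity is bounded if there is a neighborhood $U$ of $m$ such that $\|\omega\|$ is bounded on $U\setminus M_{\mathrm{sing}}$, where $\|\cdot\|$ is a norm on the bundle $\wedge^2T^*M$ (the notion does not depend on the choice of the norm). Dirac structure: a smooth vector subbundle $L\subset TM\oplus T^*M$ that is maximally isotropic for $\langle X+\alpha,Y+\beta\rangle_+=\tfrac12(i_X\beta+i_Y\alpha)$ and closed under the Dorfman bracket $[X+\alpha,Y+\beta]=[X,Y]+\mathcal{L}_X\beta-i_Yd\alpha$.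 $\mathrm{Graph}(\omega)=\{X+i_X\omega\}$. Removable: a singularity of a closed 2-form $\omega\in\Omega^2(M\setminus M_{\mathrm{sing}})$ at $m$ is removable if the closure of $\mathrm{Graph}(\omega)$ in $TM\oplus T^*M$ is a Dirac structure over a neighborhood of $m$. The exponential is $e^{-\omega}=1-\omega+\tfrac12\omega\wedge\omega-\cdots$. *)

(* Defs.v *)
From HB Require Import structures.
From mathcomp Require Import all_boot all_order all_algebra.
From mathcomp Require Import all_classical all_reals all_analysis.

Set Implicit Arguments.
Unset Strict Implicit.
Unset Printing Implicit Defensive.

Import Order.TTheory GRing.Theory Num.Theory.
Import numFieldNormedType.Exports.

Local Open Scope classical_set_scope.
Local Open Scope ring_scope.

(* The libraries have neither multivariate C^oo maps
   nor manifolds, so these are set up here. *)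

(** * Calculus on R^n *)

Section Calculus.
Variables (R : realType) (n : nat).
Implicit Types (f : 'rV[R]_n -> R) (X Y : 'rV[R]_n -> 'rV[R]_n).

Definition partial (i : 'I_n) f : 'rV[R]_n -> R :=
  fun x => 'D_(delta_mx 0 i) f x.

Definition partials (s : seq 'I_n) f : 'rV[R]_n -> R := foldr partial f s.

(* Infinite (Frechet) differentiability on U; only meant for open U, where
   it depends only on the restriction of f to U. *)
Definition smooth_on (U : set 'rV[R]_n) f : Prop :=
  forall s x, U x -> differentiable (partials s f) x.

Definition lie_bracket X Y : 'rV[R]_n -> 'rV[R]_n := fun x =>
  \row_j \sum_i (X x 0 i * partial i (fun y => Y y 0 j) x
               - Y x 0 i * partial i (fun y => X y 0 j) x).

(* A 1-form b is the row of its coefficients, b = \sum_i b_i dx_i. *)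
Definition lie_deriv1 X (b : 'rV[R]_n -> 'rV[R]_n) : 'rV[R]_n -> 'rV[R]_n :=
  fun x => \row_j \sum_i (X x 0 i * partial i (fun y => b y 0 j) x
                        + b x 0 i * partial j (fun y => X y 0 i) x).

(* A 2-form is the skew matrix A with A_ij its value on (d/dx_i, d/dx_j). *)
Definition ext_deriv1 (a : 'rV[R]_n -> 'rV[R]_n) : 'rV[R]_n -> 'M[R]_n :=
  fun x => \matrix_(i, j) (partial i (fun y => a y 0 j) x
                         - partial j (fun y => a y 0 i) x).

Definition ext_deriv2 (A : 'rV[R]_n -> 'M[R]_n) (i j k : 'I_n) :
    'rV[R]_n -> R :=
  fun x => partial i (fun y => A y j k) x + partial j (fun y => A y k i) x
         + partial k (fun y => A y i j) x.

End Calculus.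

(** * Manifolds *)

(* [cinv] is total, but only its values on the image of [cdom] matter. *)
Record chart (R : realType) (n : nat) (T : topologicalType) := Chart {
  cdom : set T;
  cmap : T -> 'rV[R]_n;
  cinv : 'rV[R]_n -> T;
  cdom_open : open cdom;
  cimg_open : open (cmap @` cdom);
  cmapK : forall p, cdom p -> cinv (cmap p) = p;
  cmap_continuous : forall p, cdom p -> {for p, continuous cmap};
  cinv_continuous : forall x, (cmap @` cdom) x -> {for x, continuous cinv}
}.

Record smooth_manifold (R : realType) (n : nat) := SmoothManifold {
  mcarrier :> topologicalType;
  manifold_hausdorff : hausdorff_space mcarrier;
  manifold_second_countable : @second_countable mcarrier;
  atlas : set (chart R n mcarrier);
  atlas_cover : forall p, exists c, atlas c /\ cdom c p;
  atlas_compat : forall c d, atlas c -> atlas d -> forall j,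
    smooth_on (cmap c @` (cdom c `&` cdom d)) (fun x => cmap d (cinv c x) 0 j)
}.

Section Frames.
Variables (R : realType) (n : nat) (M : smooth_manifold R n).

(* T_pM is presented as R^n by means of one fixed chart around each p; a
   covector is the row a with a(v) = \sum_i a_i v_i, a bilinear form on T_pM
   is the matrix A with A(u, v) = u A v^T.  The chosen chart may jump from
   point to point, so continuity and smoothness are always expressed in the
   charts of the atlas, using the frames below. *)
Definition chart_at (p : M) : chart R n M := projT1 (cid (atlas_cover p)).

(* Row i is the coordinate vector d/dx_i of the chart c, an element of T_pM. *)
Definition frame (c : chart R n M) (p : M) : 'M[R]_n :=
  'J (fun x => cmap (chart_at p) (cinv c x)) (cmap c p).

(* Row i is the covector dx_i of the chart c, an element of T_p^*M. *)
Definition coframe (c : chart R n M) (p : M) : 'M[R]_n :=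
  ('J (fun y => cmap c (cinv (chart_at p) y)) (cmap (chart_at p) p))^T.

Definition vec_in (c : chart R n M) (X : M -> 'rV[R]_n) : 'rV[R]_n -> 'rV[R]_n :=
  fun x => X (cinv c x) *m (coframe c (cinv c x))^T.

Definition cov_in (c : chart R n M) (a : M -> 'rV[R]_n) : 'rV[R]_n -> 'rV[R]_n :=
  fun x => a (cinv c x) *m (frame c (cinv c x))^T.

Definition form2_in (c : chart R n M) (w : M -> 'M[R]_n) : 'rV[R]_n -> 'M[R]_n :=
  fun x => frame c (cinv c x) *m w (cinv c x) *m (frame c (cinv c x))^T.

Definition smooth_fun (W : set M) (f : M -> R) : Prop :=
  forall c, atlas c -> smooth_on (cmap c @` (W `&` cdom c)) (f \o cinv c).

Definition is_skew (A : 'M[R]_n) : Prop := A^T = - A.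

(* Values outside W are irrelevant. *)
Definition is_form2 (W : set M) (w : M -> 'M[R]_n) : Prop :=
  (forall p, W p -> is_skew (w p)) /\
  (forall c, atlas c -> forall i j,
     smooth_on (cmap c @` (W `&` cdom c)) (fun x => form2_in c w x i j)).

Definition closed_form2 (W : set M) (w : M -> 'M[R]_n) : Prop :=
  forall c, atlas c -> forall x, (cmap c @` (W `&` cdom c)) x ->
    forall i j k, ext_deriv2 (form2_in c w) i j k x = 0.

End Frames.

(** * The bundle TM (+) T^*M *)

(* Total space: a base point together with an element of T_pM (+) T_p^*M. *)
Record gtangent (R : realType) (n : nat) (M : smooth_manifold R n) := GTangent {
  gbase : M;
  gval : 'rV[R]_n * 'rV[R]_n
}.

HB.instance Definition _ (R : realType) (n : nat) (M : smooth_manifold R n) :=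
  gen_eqMixin (gtangent M).
HB.instance Definition _ (R : realType) (n : nat) (M : smooth_manifold R n) :=
  gen_choiceMixin (gtangent M).

Section TotalSpace.
Variables (R : realType) (n : nat) (M : smooth_manifold R n).

(* The inverse of the local trivialization over the domain of c. *)
Definition of_triv (c : chart R n M) (z : 'rV[R]_n * ('rV[R]_n * 'rV[R]_n)) :
    gtangent M :=
  let p := cinv c z.1 in
  GTangent p (z.2.1 *m frame c p, z.2.2 *m coframe c p).

Definition gtangent_open (O : set (gtangent M)) : Prop :=
  forall c, atlas c ->
    open [set z | (cmap c @` cdom c) z.1 /\ O (of_triv c z)].

Lemma gtangent_openT : gtangent_open setT.
Proof.
move=> c cA; rewrite openE => z [Hz _].
have : nbhs z.1 (cmap c @` cdom c) by apply: open_nbhs_nbhs; split=> //; exact: cimg_open.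
move=> H; exists (cmap c @` cdom c, setT) => /=.
  by split => //; exact: filterT.
by move=> y [].
Qed.

Lemma gtangent_openI : setI_closed gtangent_open.
Proof.
move=> A B oA oB c cA.
rewrite (_ : [set _ | _] = [set z | (cmap c @` cdom c) z.1 /\ A (of_triv c z)]
  `&` [set z | (cmap c @` cdom c) z.1 /\ B (of_triv c z)]).
  by apply: openI; [exact: oA | exact: oB].
by apply/seteqP; split=> z /=; [move=> [? []] | move=> [[? ?] []]].
Qed.

Lemma gtangent_open_bigU (I : Type) (f : I -> set (gtangent M)) :
  (forall i, gtangent_open (f i)) -> gtangent_open (\bigcup_i f i).
Proof.
move=> of_ c cA.
rewrite (_ : [set _ | _] =
  \bigcup_i [set z | (cmap c @` cdom c) z.1 /\ f i (of_triv c z)]).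
  by apply: bigcup_open => i _; exact: of_.
apply/seteqP; split=> z /=.
  by move=> [Hz [i _ fi]]; exists i.
by move=> [i _ [Hz fi]]; split=> //; exists i.
Qed.

HB.instance Definition _ := isOpenTopological.Build (gtangent M)
  gtangent_openT gtangent_openI gtangent_open_bigU.

(* Sections are functions M -> T_pM (+) T_p^*M; values outside W are
   irrelevant. *)
Definition smooth_section (W : set M) (s : M -> 'rV[R]_n * 'rV[R]_n) : Prop :=
  forall c, atlas c -> forall j,
    smooth_on (cmap c @` (W `&` cdom c)) (fun x => vec_in c (fst \o s) x 0 j) /\
    smooth_on (cmap c @` (W `&` cdom c)) (fun x => cov_in c (snd \o s) x 0 j).

Definition fiber (L : set (gtangent M)) (p : M) : set ('rV[R]_n * 'rV[R]_n) :=
  [set e | L (GTangent p e)].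

Definition smooth_subbundle (U : set M) (L : set (gtangent M)) : Prop :=
  forall p, U p -> exists k (V : set M) (s : 'I_k -> M -> 'rV[R]_n * 'rV[R]_n),
    [/\ open V, V p, V `<=` U, forall i, smooth_section V (s i) &
      forall q, V q ->
        free [seq s i q | i <- enum 'I_k] /\
        forall e, fiber L q e <-> e \in <<[seq s i q | i <- enum 'I_k]>>%VS].

(* <X+a, Y+b>_+ = (i_X b + i_Y a) / 2. *)
Definition pairing (e1 e2 : 'rV[R]_n * 'rV[R]_n) : R :=
  2^-1 * (\sum_i e1.1 0 i * e2.2 0 i + \sum_i e2.1 0 i * e1.2 0 i).

Definition isotropic (S : set ('rV[R]_n * 'rV[R]_n)) : Prop :=
  forall e1 e2, S e1 -> S e2 -> pairing e1 e2 = 0.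

Definition maximally_isotropic (S : set ('rV[R]_n * 'rV[R]_n)) : Prop :=
  isotropic S /\
  forall V : {vspace ('rV[R]_n * 'rV[R]_n)%type},
    isotropic [set e | e \in V] -> S `<=` [set e | e \in V] ->
    [set e | e \in V] `<=` S.

(* [X+a, Y+b] = [X,Y] + L_X b - i_Y da, evaluated at p in the chart that
   presents T_pM. *)
Definition dorfman (s1 s2 : M -> 'rV[R]_n * 'rV[R]_n) :
    M -> 'rV[R]_n * 'rV[R]_n :=
  fun p =>
    let c := chart_at p in
    let x := cmap c p in
    let X := vec_in c (fst \o s1) in let a := cov_in c (snd \o s1) in
    let Y := vec_in c (fst \o s2) in let b := cov_in c (snd \o s2) in
    (lie_bracket X Y x, lie_deriv1 X b x - Y x *m ext_deriv1 a x).

Definition involutive_bundle (U : set M) (L : set (gtangent M)) : Prop :=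
  forall s1 s2,
    smooth_section U s1 -> (forall p, U p -> fiber L p (s1 p)) ->
    smooth_section U s2 -> (forall p, U p -> fiber L p (s2 p)) ->
    forall p, U p -> fiber L p (dorfman s1 s2 p).

Definition dirac_over (U : set M) (L : set (gtangent M)) : Prop :=
  [/\ smooth_subbundle U L,
      forall p, U p -> maximally_isotropic (fiber L p) &
      involutive_bundle U L].

(* Graph of a 2-form defined on W; i_X w is the row X *m w. *)
Definition graph (W : set M) (w : M -> 'M[R]_n) : set (gtangent M) :=
  [set e | W (gbase e) /\ (gval e).2 = (gval e).1 *m w (gbase e)].

End TotalSpace.

(** * Exterior algebra *)

Section Exterior.
Variables (R : realType) (n : nat).

(* a : {ffun {set 'I_n} -> R} stands for \sum_I a_I dx_I, where for
   I = {i_1 < ... < i_k} the form dx_I is dx_{i_1} /\ ... /\ dx_{i_k}. *)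
(* dx_I /\ dx_J = wedge_sign I J dx_{I u J} for disjoint I and J. *)
Definition wedge_sign (I J : {set 'I_n}) : R :=
  (-1) ^+ #|[set u : 'I_n * 'I_n | [&& u.1 \in I, u.2 \in J & (u.2 < u.1)%N]]%SET|.

Definition wedge (a b : {ffun {set 'I_n} -> R}) : {ffun {set 'I_n} -> R} :=
  [ffun K : {set 'I_n} =>
     \sum_(I : {set 'I_n} | I \subset K)
        wedge_sign I (K :\: I)%SET * a I * b (K :\: I)%SET].

Definition ext1 : {ffun {set 'I_n} -> R} :=
  [ffun K : {set 'I_n} => (K == finset.set0)%:R].

Definition ext_cov (a : 'rV[R]_n) : {ffun {set 'I_n} -> R} :=
  [ffun K : {set 'I_n} => \sum_i a 0 i * (K == [set i]%SET)%:R].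

Definition ext_form2 (A : 'M[R]_n) : {ffun {set 'I_n} -> R} :=
  \sum_(i < n) \sum_(j < n | (i < j)%N)
    A i j *: wedge (ext_cov (delta_mx 0 i)) (ext_cov (delta_mx 0 j)).

(* For a without component of degree 0 the wedge powers of exponent > n
   vanish, and this is the whole exponential series. *)
Definition ext_exp (a : {ffun {set 'I_n} -> R}) : {ffun {set 'I_n} -> R} :=
  \sum_(k < n.+1) (k`!%:R)^-1 *: iter k (wedge a) ext1.

End Exterior.

Section Metrics.
Variables (R : realType) (n : nat) (M : smooth_manifold R n).

Definition ext_coframe (c : chart R n M) (I : {set 'I_n}) (p : M) :
    {ffun {set 'I_n} -> R} :=
  \big[@wedge R n / @ext1 R n]_(i <- enum I) ext_cov (row i (coframe c p)).

Definition smooth_metric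
    (g : M -> {ffun {set 'I_n} -> R} -> {ffun {set 'I_n} -> R} -> R) : Prop :=
  [/\ forall p k (a b c : {ffun {set 'I_n} -> R}),
        g p (k *: a + b) c = k * g p a c + g p b c,
      forall p a b, g p a b = g p b a,
      forall p (a : {ffun {set 'I_n} -> R}), a != 0 -> 0 < g p a a &
      forall c, atlas c -> forall I J,
        smooth_on (cmap c @` cdom c) (fun x =>
          g (cinv c x) (ext_coframe c I (cinv c x))
                       (ext_coframe c J (cinv c x)))].

Definition metric_norm
    (g : M -> {ffun {set 'I_n} -> R} -> {ffun {set 'I_n} -> R} -> R)
    (p : M) (a : {ffun {set 'I_n} -> R}) : R := Num.sqrt (g p a a).

(* A norm on the bundle of 2-forms: a norm on each fiber, continuous on the
   total space.  coframe^T *m B *m coframe is \sum_ij B_ij dx_i (x) dx_j. *)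
Definition form2_norm (N : M -> 'M[R]_n -> R) : Prop :=
  [/\ forall p A, is_skew A -> N p A = 0 -> A = 0,
      forall p k A, is_skew A -> N p (k *: A) = `|k| * N p A,
      forall p A B, is_skew A -> is_skew B -> N p (A + B) <= N p A + N p B &
      forall c, atlas c ->
        {within [set z : 'rV[R]_n * 'M[R]_n |
                   (cmap c @` cdom c) z.1 /\ is_skew z.2],
          continuous (fun z : 'rV[R]_n * 'M[R]_n =>
            let p := cinv c z.1 in
            N p ((coframe c p)^T *m z.2 *m coframe c p))}].

End Metrics.

(** * Singularities *)

Section Singularities.
Variables (R : realType) (n : nat) (M : smooth_manifold R n).
Variables (Msing : set M) (w : M -> 'M[R]_n).

Definition has_singularity (m : M) : Prop :=
  Msing m /\
  ~ exists (U : set M) (w' : M -> 'M[R]_n),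
      [/\ open U, U m, is_form2 (~` Msing `|` U) w' &
          forall p, ~ Msing p -> w' p = w p].

(* The existence of one norm with a bounded neighborhood is equivalent to
   the same for every norm. *)
Definition bounded_singularity (m : M) : Prop :=
  exists N, form2_norm N /\
    exists (U : set M) (C : R),
      [/\ open U, U m & forall p, U p -> ~ Msing p -> N p (w p) <= C].

Definition removable (m : M) : Prop :=
  exists U : set M,
    [/\ open U, U m & dirac_over U (closure (graph (~` Msing) w))].

(* h is a continuous extension of f from M \ Msing to (M \ Msing) u {m}. *)
Definition continuous_extension (f : M -> R) (m : M) (h : M -> R) : Prop :=
  (forall p, ~ Msing p -> h p = f p) /\
  {within ~` Msing `|` [set m], continuous h}.

(* f = 1 / || exp(- w) || *)
Definition inv_norm_exp
    (g : M -> {ffun {set 'I_n} -> R} -> {ffun {set 'I_n} -> R} -> R) (p : M) : R :=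
  (metric_norm g p (ext_exp (- ext_form2 (w p))))^-1.

End Singularities.

(* Main.v *)
(* A removable singularity [m] gives a Lagrangian frame near [m], i.e. square
   matrices [X], [A] of smooth functions with [row_mx X A] of full rank and
   [A = X w] off the singular set.  If [X] is invertible at [m], then [X^-1 A]
   extends [w] smoothly, so [m] is not a singularity.  Otherwise some row vector
   [t] has [t X(m) = 0] and [t A(m) <> 0], and [t A = (t X) w] forces
   [|w| -> oo] at [m].  Then the singularity is unbounded, and [f] tends to [0]
   because [- w] is the degree 2 part of [exp(- w)]. *)

From HB Require Import structures.
Require Import Defs.
From mathcomp Require Import all_boot all_order all_algebra.
From mathcomp Require Import all_classical all_reals all_analysis.
Import Order.TTheory GRing.Theory Num.Theory.
Import numFieldNormedType.Exports.
Local Open Scope classical_set_scope.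
Local Open Scope ring_scope.

Set Implicit Arguments.
Unset Strict Implicit.
Unset Printing Implicit Defensive.

(** The fibres of the tangent bundle are presented in charts that may jump from point to point, so
    [w], [g] and a frame need not be continuous as they stand. Every estimate is therefore made in
    one fixed atlas chart around [m]. Carrying [exp(- w)] there requires that a substitution of
    covectors be a morphism of the whole exterior algebra, so that it commutes with the exponential.
    A divergent coordinate entry of [w] then bears on [g], or on a norm of 2-forms, only through a
    constant uniform in the base point near [m]; compactness of the unit sphere of the fibre
    provides it. The frame is square because density of the regular set puts a regular point near
    [m], where the fibre is a graph and so has dimension [n]. Isotropy of the fibres makes [X^-1 A]
    skew. The component of [exp(- w)] in degree 0 is 1, so its norm never vanishes, and [f] is
    positive and smooth. *)

Local Notation is_skew := Defs.is_skew.

(** * Smooth functions *)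

Section SmoothFunctions.
Variables (R : realType) (n : nat).
Implicit Types (f g : 'rV[R]_n -> R) (U V : set 'rV[R]_n).

Lemma near_eq_differentiable (V W : normedModType R) (f g : V -> W) (x : V) :
  {near x, f =1 g} -> differentiable f x -> differentiable g x.
Proof.
move=> fg df; have fgx := nbhs_singleton fg.
have [dfc dfE] := (diff_locallyP x f).1 df.
have gE : g \o shift x = cst (g x) + 'd f x +o_ 0 id.
  apply/eqaddoP => e e0; have /eqaddoP/(_ e e0) := dfE.
  have : \forall h \near (0 : V), f (h + x) = g (h + x).
    by rewrite (near_shift x)/=; near do rewrite /= sub0r addrNK.
  apply: filterS2 => h; rewrite !fctE /= => fgh; by rewrite fgh fgx.
by apply/diff_locallyP; rewrite (diff_unique dfc gE).
Unshelve. all: by end_near. Qed.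

Lemma differentiable_row (V : normedModType R) m (f : V -> 'rV[R]_m) (x : V) :
  (forall j, differentiable (fun y => f y 0 j) x) -> differentiable f x.
Proof.
move=> df.
have -> : f = \sum_j (fun y => f y 0 j *: delta_mx 0 j).
  by apply/funext => y; rewrite fct_sumE [LHS]row_sum_delta.
by apply: differentiable_sum => j; apply: differentiableZl.
Qed.

Lemma smooth_on_sub U V f : V `<=` U -> smooth_on U f -> smooth_on V f.
Proof. by move=> VU fU s x /VU; exact: fU. Qed.

Lemma smooth_on_local U f :
  (forall x, U x -> exists V, V x /\ smooth_on V f) -> smooth_on U f.
Proof. by move=> fl s x /fl[V [Vx fV]]; exact: fV. Qed.

Lemma smooth_on_differentiable U f x :
  smooth_on U f -> U x -> differentiable f x.
Proof. by move=> fU; exact: (fU [::]). Qed.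

Lemma smooth_on_continuous U f x : smooth_on U f -> U x -> {for x, continuous f}.
Proof.
by move=> fU Ux; apply: differentiable_continuous; exact: smooth_on_differentiable Ux.
Qed.

(** The recursion differentiates [f] itself first, whereas [partials] has the head of the list as
    its outermost derivative. In this form the Leibniz and chain rules give closure properties by
    induction on the order. *)
Fixpoint diff_upto k U f : Prop :=
  (forall x, U x -> differentiable f x) /\
  (if k is k'.+1 then forall i, diff_upto k' U (partial i f) else True).

Lemma smooth_onP U f : smooth_on U f <-> forall k, diff_upto k U f.
Proof.
split=> [fU k|fU s].
  elim: k f fU => [|k IHk] f fU; split=> //; try exact: (fU [::]).
  by move=> i; apply: IHk => s; have := fU (rcons s i); rewrite /partials foldr_rcons.
have {fU} := fU (size s); elim/last_ind: s f => [f []//|s i IHs] f.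
by rewrite size_rcons /partials foldr_rcons => -[_ /(_ i)]; exact: IHs.
Qed.

Lemma diff_uptoS k U f : diff_upto k.+1 U f -> diff_upto k U f.
Proof.
elim: k f => [|k IHk] f; first by case.
by move=> [df dpf]; split=> // i; apply: IHk; exact: dpf.
Qed.

Lemma diff_upto_differentiable k U f x :
  diff_upto k U f -> U x -> differentiable f x.
Proof. by case: k => [|k] [df _] /df. Qed.

Section OpenSet.
Variables (U : set 'rV[R]_n) (oU : open U).

Lemma eq_partial f g i : {in U, f =1 g} -> {in U, partial i f =1 partial i g}.
Proof.
move=> fg x /set_mem Ux; apply: near_eq_derive.
have := open_nbhs_nbhs (conj oU Ux); apply: filterS => y Uy.
by apply: fg; rewrite inE.
Qed.

Lemma eq_diff_upto k f g : {in U, f =1 g} -> diff_upto k U f -> diff_upto k U g.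
Proof.
elim: k f g => [|k IHk] f g fg [df dpf]; split=> //.
- move=> x Ux; apply: near_eq_differentiable (df x Ux).
  have := open_nbhs_nbhs (conj oU Ux); apply: filterS => y Uy.
  by apply: fg; rewrite inE.
- move=> x Ux; apply: near_eq_differentiable (df x Ux).
  have := open_nbhs_nbhs (conj oU Ux); apply: filterS => y Uy.
  by apply: fg; rewrite inE.
- by move=> i; apply: IHk (dpf i); exact: eq_partial.
Qed.

Lemma eq_smooth_on f g : {in U, f =1 g} -> smooth_on U f -> smooth_on U g.
Proof. by move=> fg /smooth_onP fU; apply/smooth_onP => k; exact: eq_diff_upto (fU k). Qed.

Lemma diff_upto_cst k (r : R) : diff_upto k U (fun=> r).
Proof.
elim: k r => [|k IHk] r; split=> //; try by move=> x _; exact: differentiable_cst.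
move=> i; apply: eq_diff_upto (IHk 0) => x _.
by rewrite /partial derive_cst.
Qed.

Lemma diff_uptoD k f g :
  diff_upto k U f -> diff_upto k U g -> diff_upto k U (fun x => f x + g x).
Proof.
elim: k f g => [|k IHk] f g [df dpf] [dg dpg]; split=> //;
  try by move=> x Ux; apply: differentiableD; [exact: df | exact: dg].
move=> i; apply: eq_diff_upto (IHk _ _ (dpf i) (dpg i)) => x /set_mem Ux.
by rewrite /partial deriveD//; apply: diff_derivable; [exact: df | exact: dg].
Qed.

Lemma diff_uptoM k f g :
  diff_upto k U f -> diff_upto k U g -> diff_upto k U (fun x => f x * g x).
Proof.
elim: k f g => [|k IHk] f g fk gk; split=> //;
  try by move=> x Ux; apply: differentiableM;
    [exact: diff_upto_differentiable fk Ux | exact: diff_upto_differentiable gk Ux].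
move=> i; have [_ dpf] := fk; have [_ dpg] := gk.
have := diff_uptoD (IHk _ _ (diff_uptoS fk) (dpg i)) (IHk _ _ (diff_uptoS gk) (dpf i)).
apply: eq_diff_upto => x /set_mem Ux.
by rewrite /partial deriveM//; apply: diff_derivable;
  [exact: diff_upto_differentiable fk Ux | exact: diff_upto_differentiable gk Ux].
Qed.

Lemma partial_comp (h : R -> R) (dh : R) f i x :
  is_derive (f x) 1 h dh -> differentiable f x ->
  partial i (fun y => h (f y)) x = dh * partial i f x.
Proof.
move=> hd fd; have hd' : differentiable h (f x) by apply/derivable1_diffP; exact: ex_derive.
rewrite /partial deriveE; last exact: (differentiable_comp fd hd').
rewrite (diff_comp fd hd') /= deriveE//; set u := 'd f x _.
(* Read as a multiple of 1, the scalar [u] can be pulled out of the differential of [h] by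
   linearity. *)
have uE : u = u *: (1 : R^o) by rewrite [RHS]mulr1.
by rewrite {1}uE linearZ /= -deriveE// (@derive_val _ _ _ _ _ _ _ hd) mulrC.
Qed.

Lemma smooth_on_cst (r : R) : smooth_on U (fun=> r).
Proof. by apply/smooth_onP => k; exact: diff_upto_cst. Qed.

Lemma smooth_onD f g : smooth_on U f -> smooth_on U g ->
  smooth_on U (fun x => f x + g x).
Proof. by move=> /smooth_onP ? /smooth_onP ?; apply/smooth_onP => k; exact: diff_uptoD. Qed.

Lemma smooth_onM f g : smooth_on U f -> smooth_on U g ->
  smooth_on U (fun x => f x * g x).
Proof. by move=> /smooth_onP ? /smooth_onP ?; apply/smooth_onP => k; exact: diff_uptoM. Qed.

Lemma smooth_onN f : smooth_on U f -> smooth_on U (fun x => - f x).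
Proof.
move=> fU; apply: eq_smooth_on (smooth_onM (smooth_on_cst (-1)) fU) => x _.
by rewrite mulN1r.
Qed.

Lemma smooth_on_sum (I : Type) (r : seq I) (P : pred I) (F : I -> 'rV[R]_n -> R) :
  (forall i, P i -> smooth_on U (F i)) -> smooth_on U (fun x => \sum_(i <- r | P i) F i x).
Proof.
move=> FU; elim: r => [|i r IHr].
  by apply: eq_smooth_on (smooth_on_cst 0) => x _; rewrite big_nil.
case Pi: (P i).
  by apply: eq_smooth_on (smooth_onD (FU _ Pi) IHr) => x _; rewrite big_cons Pi.
by apply: eq_smooth_on IHr => x _; rewrite big_cons Pi.
Qed.

Lemma smooth_on_prod (I : Type) (r : seq I) (P : pred I) (F : I -> 'rV[R]_n -> R) :
  (forall i, P i -> smooth_on U (F i)) -> smooth_on U (fun x => \prod_(i <- r | P i) F i x).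
Proof.
move=> FU; elim: r => [|i r IHr].
  by apply: eq_smooth_on (smooth_on_cst 1) => x _; rewrite big_nil.
case Pi: (P i).
  by apply: eq_smooth_on (smooth_onM (FU _ Pi) IHr) => x _; rewrite big_cons Pi.
by apply: eq_smooth_on IHr => x _; rewrite big_cons Pi.
Qed.

(** The derivative is the product of [- f^-1 * f^-1] with a derivative of [f], so regularity of the
    inverse at one order gives the next. *)
Lemma smooth_onV f : (forall x, U x -> f x != 0) ->
  smooth_on U f -> smooth_on U (fun x => (f x)^-1).
Proof.
move=> f0 /smooth_onP fU; apply/smooth_onP; elim=> [|k IHk]; split=> //;
  try by move=> x Ux; apply: differentiableV; [exact: diff_upto_differentiable (fU 0) Ux | exact: f0].
move=> i; have [_ dpf] := fU k.+1.
have := diff_uptoM (diff_uptoM (diff_upto_cst k (-1)) (diff_uptoM IHk IHk)) (dpf i).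
apply: eq_diff_upto => x /set_mem Ux.
rewrite /partial deriveV ?f0//; last exact/diff_derivable/(diff_upto_differentiable (fU 0)).
by rewrite expr2 invfM mulN1r.
Qed.

(** The derivative is written with [sqrt f * f^-1] in place of [1 / sqrt f]: the induction then
    involves the root itself and the inverse of [f], already known to be smooth. *)
Lemma smooth_on_sqrt f : (forall x, U x -> 0 < f x) ->
  smooth_on U f -> smooth_on U (fun x => Num.sqrt (f x)).
Proof.
move=> f0 fU; have /smooth_onP fUk := fU.
have fd x : U x -> differentiable f x by exact: smooth_on_differentiable.
have sd x : U x -> differentiable (fun x => Num.sqrt (f x)) x.
  move=> Ux; apply: (@differentiable_comp _ _ _ _ f Num.sqrt); first exact: fd.
  by apply/derivable1_diffP; have := is_derive1_sqrt (f0 x Ux).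
have /smooth_onP fVk := smooth_onV (fun x Ux => lt0r_neq0 (f0 x Ux)) fU.
apply/smooth_onP; elim=> [|k IHk]; split=> //; try exact: sd.
move=> i; have [_ dpf] := fUk k.+1.
have := diff_uptoM (diff_uptoM (diff_upto_cst k 2^-1) (diff_uptoM IHk (fVk k))) (dpf i).
apply: eq_diff_upto => x /set_mem Ux; have fx := f0 x Ux.
rewrite (partial_comp _ (is_derive1_sqrt fx) (fd x Ux)); congr (_ * _).
rewrite invfM; congr (_ * _); have sx : Num.sqrt (f x) != 0 by rewrite lt0r_neq0 ?sqrtr_gt0.
by rewrite -[X in _ / X]sqr_sqrtr ?ltW// expr2 invfM mulrA divff// mul1r.
Qed.

Lemma smooth_on_mulmx a b c (A : 'rV[R]_n -> 'M[R]_(a, b)) (B : 'rV[R]_n -> 'M[R]_(b, c)) :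
  (forall i j, smooth_on U (fun x => A x i j)) ->
  (forall i j, smooth_on U (fun x => B x i j)) ->
  forall i j, smooth_on U (fun x => (A x *m B x) i j).
Proof.
move=> AU BU i j; apply: (@eq_smooth_on (fun x => \sum_k A x i k * B x k j)).
  by move=> x _; rewrite mxE.
by apply: smooth_on_sum => k _; exact: smooth_onM.
Qed.

Lemma smooth_on_det m (A : 'rV[R]_n -> 'M[R]_m) :
  (forall i j, smooth_on U (fun x => A x i j)) -> smooth_on U (fun x => \det (A x)).
Proof.
move=> AU; apply: smooth_on_sum => s _; apply: smooth_onM; first exact: smooth_on_cst.
by apply: smooth_on_prod => i _.
Qed.

Lemma smooth_on_invmx m (A : 'rV[R]_n -> 'M[R]_m) :
  (forall x, U x -> A x \in unitmx) ->
  (forall i j, smooth_on U (fun x => A x i j)) ->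
  forall i j, smooth_on U (fun x => invmx (A x) i j).
Proof.
move=> Au AU i j.
apply: (@eq_smooth_on (fun x => (\det (A x))^-1 * ((-1) ^+ (j + i) *
    \det (row' j (col' i (A x)))))).
  by move=> x /set_mem Ux; rewrite /invmx Au// !mxE.
apply: smooth_onM.
  apply: smooth_onV; last exact: smooth_on_det.
  by move=> x /Au; rewrite unitmxE unitfE.
apply: smooth_onM; first exact: smooth_on_cst.
apply: smooth_on_det => k l; apply: eq_smooth_on (AU (lift j k) (lift i l)).
by move=> x _; rewrite !mxE.
Qed.

End OpenSet.
End SmoothFunctions.

(** * Exterior algebra *)

Section ExteriorAlgebra.
Local Close Scope classical_set_scope.
Variables (R : realType) (n : nat).
Local Notation ext := {ffun {set 'I_n} -> R}.
Implicit Types (a b c : ext) (I J K : {set 'I_n}).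

Definition ext_basis I : ext := [ffun K => (K == I)%:R].

Let scalE k a K : (k *: a) K = k * a K. Proof. by rewrite ffunE. Qed.
Let addE a b K : (a + b) K = a K + b K. Proof. by rewrite ffunE. Qed.

Lemma ext_basis_sum a : a = \sum_I a I *: ext_basis I.
Proof.
apply/ffunP => K; rewrite sum_ffunE (bigD1 K)//= big1.
  by rewrite scalE ffunE eqxx mulr1 addr0.
by move=> I IK; rewrite scalE ffunE eq_sym (negPf IK) mulr0.
Qed.

(** Reduces the multilinear identities below to basis forms, one argument at a time. *)
Lemma linear_ext_eq (V : lmodType R) (F G : ext -> V) :
  linear F -> linear G -> (forall I, F (ext_basis I) = G (ext_basis I)) -> F =1 G.
Proof.
move=> lF lG FG a.
pose F' : {linear ext -> V} := HB.pack F (GRing.isLinear.Build _ _ _ _ F lF).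
pose G' : {linear ext -> V} := HB.pack G (GRing.isLinear.Build _ _ _ _ G lG).
rewrite -[F]/(F' : _ -> _) -[G]/(G' : _ -> _) [a]ext_basis_sum !linear_sum.
by apply: eq_bigr => I _; rewrite !linearZ /= FG.
Qed.

Fact wedge_is_linear_r a : linear (wedge a).
Proof.
move=> k b c; apply/ffunP => K; rewrite addE scalE ![wedge _ _ _]ffunE mulr_sumr -big_split /=.
by apply: eq_bigr => I _; rewrite addE scalE mulrDr mulrCA.
Qed.
HB.instance Definition _ a :=
  GRing.isLinear.Build R ext ext *:%R (wedge a) (wedge_is_linear_r a).

Fact wedge_is_linear_l b : linear ((@wedge R n)^~ b).
Proof.
move=> k a c; apply/ffunP => K; rewrite addE scalE ![wedge _ _ _]ffunE mulr_sumr -big_split /=.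
apply: eq_bigr => I _; rewrite addE scalE mulrDr mulrDl; congr (_ + _).
by rewrite mulrCA -!mulrA.
Qed.

(** The flipped product is named so that linearity in the left factor can also be a canonical
    structure. *)
Definition wedger b a := wedge a b.
HB.instance Definition _ b :=
  GRing.isLinear.Build R ext ext *:%R (wedger b) (wedge_is_linear_l b).

Lemma wedgeZl k a b : wedge (k *: a) b = k *: wedge a b.
Proof. exact: (linearZ_LR (wedger b)). Qed.

Lemma wedge0l b : wedge 0 b = 0.
Proof. exact: (linear0 (wedger b)). Qed.

Lemma wedge_suml T (r : seq T) (P : pred T) (F : T -> ext) b :
  wedge (\sum_(i <- r | P i) F i) b = \sum_(i <- r | P i) wedge (F i) b.
Proof. exact: (linear_sum (wedger b)). Qed.

Lemma disjoint_setUl I J K :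
  [disjoint (I :|: J)%SET & K] = [disjoint I & K] && [disjoint J & K].
Proof. by rewrite -!finset.setI_eq0 finset.setIUl finset.setU_eq0. Qed.

Lemma disjoint_setUr I J K :
  [disjoint I & (J :|: K)%SET] = [disjoint I & J] && [disjoint I & K].
Proof. by rewrite -!finset.setI_eq0 finset.setIUr finset.setU_eq0. Qed.

Lemma wedge_basis I J : wedge (ext_basis I) (ext_basis J) =
  if [disjoint I & J] then wedge_sign R I J *: ext_basis (I :|: J)%SET else 0.
Proof.
have dU : [disjoint I & J] -> ((I :|: J) :\: I)%SET = J.
  move=> dIJ; rewrite finset.setDUl finset.setDv finset.set0U.
  by apply/finset.setDidPl; rewrite disjoint_sym.
apply/ffunP => K; rewrite [LHS]ffunE.
have -> : (if [disjoint I & J] then wedge_sign R I J *: ext_basis (I :|: J)%SET else 0) K =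
    if [disjoint I & J] then wedge_sign R I J * (K == (I :|: J)%SET)%:R else 0.
  by case: ifP => _; rewrite ?scalE ffunE.
have [dIJ|ndIJ] := boolP [disjoint I & J]; last first.
  rewrite big1// => L LK; rewrite !ffunE; have [->|] := eqVneq L I; last by rewrite mulr0 mul0r.
  have [KLJ|] := eqVneq (K :\: I)%SET J; last by rewrite mulr0.
  by move: ndIJ; rewrite -KLJ -finset.setI_eq0 finset.setIDA finset.setIC -finset.setIDA
    finset.setDv finset.setI0 eqxx.
have [->|KIJ] := eqVneq K (I :|: J)%SET.
  rewrite (bigD1 I) ?finset.subsetUl//= big1 ?addr0.
    by rewrite !ffunE dU// !eqxx !mulr1.
  by move=> L /andP[_ LI]; rewrite !ffunE (negPf LI) mulr0 mul0r.
rewrite mulr0 big1// => L LK; rewrite !ffunE.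
have [LI|] := eqVneq L I; last by rewrite mulr0 mul0r.
have [KLJ|] := eqVneq (K :\: L)%SET J; last by rewrite mulr0.
move: KIJ; rewrite -LI -KLJ finset.setUC finset.setDE finset.setUIl.
rewrite [(~: L :|: L)%SET]finset.setUC finset.setUCr finset.setIT.
by rewrite (finset.setUidPl LK) eqxx.
Qed.

(** The exponent counts inversions, and the inversions of a disjoint union against [K] split
    according to the part that they start from. *)
Lemma wedge_signUl I J K : [disjoint I & J] ->
  wedge_sign R (I :|: J)%SET K = wedge_sign R I K * wedge_sign R J K.
Proof.
move=> dIJ; rewrite /wedge_sign -exprD; congr (_ ^+ _).
rewrite -cardsUI [X in (_ + X)%N](_ : _ = 0%N) ?addn0; last first.
  apply/eqP; rewrite cards_eq0; apply/eqP/setP => u; rewrite !inE.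
  apply/negP => /andP[/and3P[uI _ _] /and3P[uJ _ _]].
  by move/pred0P: dIJ => /(_ u.1)/=; rewrite uI uJ.
by congr #|pred_of_set _|; apply/setP => u; rewrite !inE -!andb_orl.
Qed.

Lemma wedge_signUr I J K : [disjoint J & K] ->
  wedge_sign R I (J :|: K)%SET = wedge_sign R I J * wedge_sign R I K.
Proof.
move=> dIJ; rewrite /wedge_sign -exprD; congr (_ ^+ _).
rewrite -cardsUI [X in (_ + X)%N](_ : _ = 0%N) ?addn0; last first.
  apply/eqP; rewrite cards_eq0; apply/eqP/setP => u; rewrite !inE.
  apply/negP => /andP[/and3P[_ uI _] /and3P[_ uJ _]].
  by move/pred0P: dIJ => /(_ u.2)/=; rewrite uI uJ.
congr #|pred_of_set _|; apply/setP => u; rewrite !inE.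
by case: (u.1 \in I) => //=; rewrite andb_orl.
Qed.

Lemma wedge_signK I J : wedge_sign R I J * wedge_sign R I J = 1.
Proof. by rewrite /wedge_sign -expr2 sqrr_sign. Qed.

(** On basis forms both sides vanish unless the three index sets are pairwise disjoint; otherwise
    both signs count the inversions between all three pairs of sets. *)
Lemma wedgeA a b c : wedge a (wedge b c) = wedge (wedge a b) c.
Proof.
move: a; apply: linear_ext_eq => [k x y|k x y|I].
- exact: (linearP (wedger (wedge b c))).
- by rewrite -/(wedger b _) linearP; exact: (linearP (wedger c)).
move: b; apply: linear_ext_eq => [k x y|k x y|J].
- by rewrite -/(wedger c _) !linearP.
- by rewrite linearP; exact: (linearP (wedger c)).
move: c; apply: linear_ext_eq => [k x y|k x y|K]; [by rewrite !linearP..|].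
rewrite !wedge_basis; have [dIJ|] := boolP [disjoint I & J]; last first.
  move=> ndIJ; rewrite wedge0l.
  case: ifP => _; rewrite ?linear0// linearZ /= wedge_basis.
  by rewrite disjoint_setUr (negPf ndIJ) scaler0.
have [dJK|] := boolP [disjoint J & K]; last first.
  move=> ndJK; rewrite linear0 wedgeZl wedge_basis.
  by rewrite disjoint_setUl (negPf ndJK) andbF scaler0.
rewrite linearZ /= wedgeZl !wedge_basis disjoint_setUl disjoint_setUr dIJ dJK andbT /=.
case: ifP => // dIK; rewrite ?scaler0// !scalerA finset.setUA; congr (_ *: _).
by rewrite wedge_signUl// wedge_signUr// mulrC -mulrA.
Qed.

Lemma ext1E : ext1 R n = ext_basis finset.set0.
Proof. by apply/ffunP => K; rewrite !ffunE. Qed.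

Lemma wedge_sign0l I : wedge_sign R finset.set0 I = 1.
Proof.
rewrite /wedge_sign (_ : [set _ | _]%SET = finset.set0) ?cards0//.
by apply/setP => u; rewrite !inE.
Qed.

Lemma wedge_sign0r I : wedge_sign R I finset.set0 = 1.
Proof.
rewrite /wedge_sign (_ : [set _ | _]%SET = finset.set0) ?cards0//.
by apply/setP => u; rewrite !inE andbF.
Qed.

Lemma wedge1l a : wedge (ext1 R n) a = a.
Proof.
move: a; apply: linear_ext_eq => [||I]; [exact: linearP|by []|].
by rewrite ext1E wedge_basis wedge_sign0l finset.set0U scale1r -setI_eq0 finset.set0I eqxx.
Qed.

Lemma wedge1r a : wedge a (ext1 R n) = a.
Proof.
move: a; apply: linear_ext_eq => [||I]; [exact: (linearP (wedger _))|by []|].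
by rewrite ext1E wedge_basis wedge_sign0r finset.setU0 scale1r -setI_eq0 finset.setI0 eqxx.
Qed.

Lemma ext_covE (v : 'rV[R]_n) : ext_cov v = \sum_i v 0 i *: ext_basis [set i]%SET.
Proof. by apply/ffunP => K; rewrite ffunE sum_ffunE; apply: eq_bigr => i _; rewrite scalE ffunE. Qed.

Fact ext_cov_is_linear : linear (@ext_cov R n).
Proof.
move=> k u v; rewrite !ext_covE scaler_sumr -big_split /=; apply: eq_bigr => i _.
by rewrite !mxE scalerDl scalerA.
Qed.
HB.instance Definition _ :=
  GRing.isLinear.Build R 'rV[R]_n ext *:%R (@ext_cov R n) ext_cov_is_linear.

Lemma ext_cov_delta i : ext_cov (delta_mx 0 i) = ext_basis [set i]%SET.
Proof.
rewrite ext_covE (bigD1 i)//= big1 ?addr0 => [|j ji]; rewrite mxE eqxx ?eqxx ?scale1r//.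
by rewrite (negPf ji) scale0r.
Qed.

Lemma wedge_sign1 i J :
  wedge_sign R [set i] J = (-1) ^+ #|[set j in J | (j < i)%N]%SET|.
Proof.
rewrite /wedge_sign; congr (_ ^+ _).
rewrite -[RHS](card_imset _ (_ : injective (fun j => (i, j)))); last by move=> ? ? [].
congr #|pred_of_set _|; apply/setP => -[k j]; rewrite !inE /=.
apply/idP/imsetP => [/and3P[/eqP -> jJ ji]|[l]]; first by exists j; rewrite ?inE ?jJ.
by rewrite !inE => /andP[lJ li] [-> ->]; rewrite eqxx lJ.
Qed.

Lemma wedge_basis1 i j : wedge (ext_basis [set i]%SET) (ext_basis [set j]%SET) =
  - wedge (ext_basis [set j]%SET) (ext_basis [set i]%SET).
Proof.
rewrite !wedge_basis disjoint_sym; case: ifPn => [dij|]; last by rewrite oppr0.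
have ij : i != j by move: dij; rewrite finset.disjoints1 inE eq_sym.
rewrite !wedge_sign1 finset.setUC -scaleNr; congr (_ *: _).
have sE (k l : 'I_n) : #|[set m in [set k] | (m < l)%N]%SET| = (k < l)%N.
  case: ltnP => kl /=.
    rewrite (_ : [set _ in _ | _]%SET = [set k]%SET) ?cards1//.
    by apply/setP => m; rewrite !inE; case: eqP => // ->.
  apply/eqP; rewrite cards_eq0; apply/eqP/setP => m; rewrite !inE.
  by apply/negP => /andP[/eqP ->]; rewrite ltnNge kl.
rewrite !sE; case: ltngtP => [_|_|/val_inj E]; rewrite ?expr0 ?expr1 ?opprK//.
by move: ij; rewrite E eqxx.
Qed.

Lemma wedge_covE (u v : 'rV[R]_n) : wedge (ext_cov u) (ext_cov v) =
  \sum_i \sum_j (u 0 i * v 0 j) *: wedge (ext_basis [set i]%SET) (ext_basis [set j]%SET).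
Proof.
rewrite !ext_covE wedge_suml; apply: eq_bigr => i _.
rewrite linear_sum; apply: eq_bigr => j _ /=.
by rewrite wedgeZl linearZ scalerA.
Qed.

Lemma wedge_covC (u v : 'rV[R]_n) :
  wedge (ext_cov u) (ext_cov v) = - wedge (ext_cov v) (ext_cov u).
Proof.
rewrite !wedge_covE exchange_big -sumrN; apply: eq_bigr => i _.
rewrite -sumrN; apply: eq_bigr => j _ /=.
by rewrite wedge_basis1 scalerN mulrC.
Qed.

Lemma wedge_covv (u : 'rV[R]_n) : wedge (ext_cov u) (ext_cov u) = 0.
Proof.
have /eqP := wedge_covC u u; rewrite -addr_eq0 -mulr2n -scaler_nat scaler_eq0.
by rewrite pnatr_eq0 => /eqP.
Qed.

(** * Substitution of covectors in the exterior algebra *)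

Section Pullback.
Variable P : 'M[R]_n.
Local Notation x i := (ext_cov (row i P)).

Definition pull_basis I : ext := \big[@wedge R n / @ext1 R n]_(i <- enum I) x i.

(** This is the algebra endomorphism that sends [dx_i] to row [i] of [P]. For [P := coframe c p] the
    family [pull_basis] is [ext_coframe c], so [pull] turns coefficients in the chart [c] into a
    form at [p]. *)
Definition pull a : ext := \sum_I a I *: pull_basis I.

Fact pull_is_linear : linear pull.
Proof.
move=> k a b; rewrite /pull scaler_sumr -big_split /=.
by apply: eq_bigr => I _; rewrite addE scalE scalerDl scalerA.
Qed.
HB.instance Definition _ := GRing.isLinear.Build R ext ext *:%R pull pull_is_linear.

Lemma pull_ext_basis I : pull (ext_basis I) = pull_basis I.
Proof.
rewrite /pull (bigD1 I)//= big1 ?addr0 => [|J JI]; rewrite ffunE ?eqxx ?scale1r//.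
by rewrite (negPf JI) scale0r.
Qed.

Lemma wedge_cov_big i (s t : seq 'I_n) :
  wedge (x i) (\big[@wedge R n / @ext1 R n]_(j <- s ++ t) x j) =
  (-1) ^+ size s *: \big[@wedge R n / @ext1 R n]_(j <- s ++ i :: t) x j.
Proof.
elim: s => [|j s IHs] /=; first by rewrite !big_cons scale1r.
rewrite !big_cons wedgeA wedge_covC -scaleN1r wedgeZl -wedgeA IHs linearZ /= scalerA.
by rewrite exprS.
Qed.

Lemma sorted_enum_set I : sorted (relpre val ltn) (enum I).
Proof.
have -> : enum I = [seq j <- enum 'I_n | j \in I] by rewrite {1}/enum_mem enumT.
apply: sorted_filter; first by move=> i j k; exact: ltn_trans.
by rewrite -sorted_map val_enum_ord iota_ltn_sorted.
Qed.

Lemma eq_enum_set I (s : seq 'I_n) :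
  sorted (relpre val ltn) s -> s =i I -> enum I = s.
Proof.
move=> s_sorted sI; apply: (irr_sorted_eq _ _ (sorted_enum_set I) s_sorted).
- by move=> i j k; exact: ltn_trans.
- by move=> i; exact: ltnn.
- by move=> j; rewrite mem_enum sI.
Qed.

(** Locates the slot of [i] in the increasing enumeration. The length of [s] is the exponent in
    [wedge_sign1], which matches the transpositions needed to bring the covector of [i] into its
    slot. *)
Lemma enum_setU1 i I : i \notin I -> exists s t, [/\ enum I = s ++ t,
  enum (i |: I)%SET = s ++ i :: t & size s = #|[set j in I | (j < i)%N]%SET|].
Proof.
move=> iI; pose s := enum [set j in I | (j < i)%N]%SET.
pose t := enum [set j in I | (i < j)%N]%SET.
have ltT : transitive (relpre val ltn : rel 'I_n) by move=> j k l; exact: ltn_trans.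
have ss : all (relpre val ltn ^~ i) s by apply/allP => j; rewrite mem_enum inE => /andP[].
have tt : all (relpre val ltn i) t by apply/allP => j; rewrite mem_enum inE => /andP[].
have sorted_it : sorted (relpre val ltn) (s ++ i :: t).
  rewrite sorted_pairwise// pairwise_cat allrel_consr ss/= -!sorted_pairwise//.
  rewrite !sorted_enum_set tt !andbT; apply/allrelP => j k js kt.
  exact: ltT (allP ss j js) (allP tt k kt).
exists s, t; split; last by rewrite cardE.
- apply: eq_enum_set => [|j]; last first.
    rewrite mem_cat !mem_enum !inE; have [->|ji] := eqVneq j i; first by rewrite (negPf iI).
    by move: ji; rewrite neq_ltn; case: (j \in I).
  apply: (subseq_sorted ltT) sorted_it; apply: cat_subseq => //.
  exact: subseq_cons.
- apply: eq_enum_set => // j; rewrite mem_cat !inE !mem_enum !inE.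
  have [->|ji] := eqVneq j i; first by rewrite orbT.
  by move: ji; rewrite neq_ltn; case: (j \in I).
Qed.

Lemma wedge_cov_pull_basis i I : wedge (x i) (pull_basis I) =
  if i \in I then 0 else wedge_sign R [set i]%SET I *: pull_basis (i |: I)%SET.
Proof.
case: ifPn => [iI|/enum_setU1[s [t [eI eiI sz]]]]; last first.
  by rewrite /pull_basis eI eiI wedge_sign1 -sz wedge_cov_big.
have /enum_setU1[s [t [_ eI _]]] : i \notin (I :\ i)%SET by rewrite !inE eqxx.
rewrite finset.setD1K// in eI.
(* The factor of [i], already present, is moved to the front; multiplying by it once more gives a
   square, hence 0. *)
have -> : pull_basis I = (-1) ^+ size s *:
    wedge (x i) (\big[@wedge R n / @ext1 R n]_(j <- s ++ t) x j).
  by rewrite wedge_cov_big// scalerA -expr2 sqrr_sign scale1r /pull_basis eI.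
by rewrite linearZ /= wedgeA wedge_covv wedge0l scaler0.
Qed.

Lemma pull_basis0 : pull_basis finset.set0 = ext1 R n.
Proof. by rewrite /pull_basis enum_set0 big_nil. Qed.

Lemma pull_ext1 : pull (ext1 R n) = ext1 R n.
Proof. by rewrite {1}ext1E pull_ext_basis pull_basis0. Qed.

Lemma wedge_cov_pull i a :
  wedge (x i) (pull a) = pull (wedge (ext_basis [set i]%SET) a).
Proof.
move: a; apply: linear_ext_eq => [k a b|k a b|I]; [by rewrite !linearP..|].
rewrite pull_ext_basis wedge_cov_pull_basis wedge_basis finset.disjoints1.
by case: ifP => _; rewrite ?linear0 // linearZ /= pull_ext_basis.
Qed.

(** [wedge_cov_pull] is the case of one covector on the left. A basis form of higher degree is
    reduced to it by splitting off one index, with an induction on the degree that keeps [b]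
    arbitrary. *)
Lemma pull_wedge a b : pull (wedge a b) = wedge (pull a) (pull b).
Proof.
move: a; apply: linear_ext_eq => [k a c|k a c|I].
- by rewrite -/(wedger b (k *: a + c)) !linearP.
- by rewrite linearP; exact: (linearP (wedger (pull b))).
have [m] := ubnP #|I|; elim: m I b => // m IHm I b Im.
have [->|[i iI]] := finset.set_0Vmem I.
  by rewrite pull_ext_basis pull_basis0 -ext1E !wedge1l.
have iJ : i \notin (I :\ i)%SET by rewrite !inE eqxx.
have Jm : (#|(I :\ i)%SET| < m)%N by rewrite (cardsD1 i I) iI in Im.
rewrite -(finset.setD1K iI); move: (I :\ i)%SET iJ Jm => J iJ Jm.
have -> : ext_basis (i |: J)%SET =
    wedge_sign R [set i]%SET J *: wedge (ext_basis [set i]%SET) (ext_basis J).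
  by rewrite wedge_basis finset.disjoints1 iJ scalerA wedge_signK scale1r.
rewrite wedgeZl -wedgeA !linearZ /= -!wedge_cov_pull IHm// wedgeZl.
by rewrite wedgeA.
Qed.

Lemma pull_ext_cov (v : 'rV[R]_n) : pull (ext_cov v) = ext_cov (v *m P).
Proof.
rewrite ext_covE linear_sum [RHS]ext_covE.
(* A basis covector is read as its product with the unit, so that [wedge_cov_pull] computes its
   image. *)
under eq_bigr do rewrite linearZ /= -[ext_basis _]wedge1r -wedge_cov_pull pull_ext1 wedge1r
  ext_covE scaler_sumr.
rewrite exchange_big; apply: eq_bigr => j _ /=.
by rewrite mxE scaler_suml; apply: eq_bigr => i _; rewrite mxE scalerA.
Qed.

Lemma pull_ext_exp a : pull (ext_exp a) = ext_exp (pull a).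
Proof.
rewrite linear_sum; apply: eq_bigr => k _; rewrite linearZ /=; congr (_ *: _).
by elim: (k : nat) => [|l IHl] /=; rewrite ?pull_ext1// pull_wedge IHl.
Qed.

End Pullback.

(** A change of coframe does not respect the order [i < j]; the half-sum over all pairs is the form
    in which it can be carried out. *)
Lemma ext_form2E (A : 'M[R]_n) : is_skew A -> ext_form2 A = 2^-1 *:
  \sum_i \sum_j A i j *: wedge (ext_cov (delta_mx 0 i)) (ext_cov (delta_mx 0 j)).
Proof.
move=> skA; pose w i j := A i j *: wedge (ext_cov (delta_mx 0 i)) (ext_cov (delta_mx 0 j)).
have AT i j : A j i = - A i j by move/matrixP: skA => /(_ i j); rewrite !mxE.
have wC i j : w j i = w i j by rewrite /w AT wedge_covC scalerN scaleNr opprK.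
have w0 i : w i i = 0 by rewrite /w wedge_covv scaler0.
have wE : \sum_i \sum_j w i j = \sum_(i < n) \sum_(j < n | (i < j)%N) w i j *+ 2.
  transitivity (\sum_(i < n) (\sum_(j < n | (i < j)%N) w i j +
                               \sum_(j < n | (j < i)%N) w i j)).
    apply: eq_bigr => i _; rewrite (bigID (fun j : 'I_n => (i < j)%N))/=; congr (_ + _).
    under eq_bigl do rewrite -leqNgt.
    rewrite (bigD1 i)//= w0 add0r; apply: eq_bigl => j.
    by rewrite ltn_neqAle andbC.
  rewrite big_split /= [X in _ + X](exchange_big_dep predT)//=.
  rewrite -big_split; apply: eq_bigr => i _ /=.
  rewrite sumrMnl mulr2n; congr (_ + _); apply: eq_bigr => j _; exact: wC.
rewrite wE.
rewrite scaler_sumr; apply: eq_bigr => i _; rewrite scaler_sumr; apply: eq_bigr => j _.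
by rewrite -scaler_nat scalerA mulVf ?scale1r// pnatr_eq0.
Qed.

Lemma pull_ext_form2 (P B : 'M[R]_n) : is_skew B ->
  pull P (ext_form2 B) = ext_form2 (P^T *m B *m P).
Proof.
move=> skB; have skP : is_skew (P^T *m B *m P).
  by rewrite /is_skew !trmx_mul trmxK skB mulNmx mulmxN mulmxA.
rewrite !ext_form2E// linearZ /=; congr (_ *: _).
(* Contracting the inner sum leaves one product per row of [A], so that [P] acts on covectors
   only. *)
have E (A : 'M[R]_n) : \sum_i \sum_j A i j *: wedge (ext_cov (delta_mx 0 i))
    (ext_cov (delta_mx 0 j)) = \sum_i wedge (ext_cov (delta_mx 0 i)) (ext_cov (row i A)).
  apply: eq_bigr => i _; rewrite [ext_cov (row i A)]ext_covE linear_sum.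
  by apply: eq_bigr => j _; rewrite linearZ /= mxE !ext_cov_delta.
rewrite !E linear_sum.
under eq_bigr do rewrite /= pull_wedge !pull_ext_cov ext_covE wedge_suml.
rewrite exchange_big; apply: eq_bigr => j _ /=.
rewrite ext_cov_delta -mulmxA row_mul mulmx_sum_row linear_sum linear_sum.
apply: eq_bigr => i _ /=.
by rewrite wedgeZl -linearZ linearZ /= !linearZ -row_mul -rowE !mxE.
Qed.

Lemma pull_comp (P Q : 'M[R]_n) a : pull Q (pull P a) = pull (P *m Q) a.
Proof.
move: a; apply: linear_ext_eq => [k a b|k a b|I]; [by rewrite !linearP..|].
rewrite !pull_ext_basis /pull_basis (big_morph _ (pull_wedge Q) (pull_ext1 Q)).
by apply: eq_bigr => i _; rewrite pull_ext_cov row_mul.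
Qed.

Lemma pull1 a : pull 1%:M a = a.
Proof.
move: a; apply: linear_ext_eq => [k a b|//|I]; first exact: linearP.
have [m] := ubnP #|I|; elim: m I => // m IHm I Im.
have [->|[i iI]] := finset.set_0Vmem I.
  by rewrite pull_ext_basis pull_basis0 ext1E.
have iJ : i \notin (I :\ i)%SET by rewrite !inE eqxx.
have Jm : (#|(I :\ i)%SET| < m)%N by rewrite (cardsD1 i I) iI in Im.
rewrite -(finset.setD1K iI); move: (I :\ i)%SET iJ Jm => J iJ Jm.
have -> : ext_basis (i |: J)%SET =
    wedge_sign R [set i]%SET J *: wedge (ext_basis [set i]%SET) (ext_basis J).
  by rewrite wedge_basis finset.disjoints1 iJ scalerA wedge_signK scale1r.
by rewrite linearZ /= -wedge_cov_pull IHm// row1 ext_cov_delta.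
Qed.

Lemma pull_eq0 (P Q : 'M[R]_n) a : P *m Q = 1%:M -> pull P a = 0 -> a = 0.
Proof. by move=> PQ Pa; rewrite -[a]pull1 -PQ -pull_comp Pa linear0. Qed.

(** The degree filtration, which is multiplicative. The power [k] of a 2-form starts in degree
    [2 k], so only [k = 0] and [k = 1] reach degrees 0 and 2 of its exponential. *)
Definition vanish_below d a := forall K, (#|K| < d)%N -> a K = 0.

Lemma vanish_below_wedge d e a b :
  vanish_below d a -> vanish_below e b -> vanish_below (d + e) (wedge a b).
Proof.
move=> a0 b0 K Kde; rewrite ffunE big1// => I IK.
have [Id|dI] := ltnP #|I| d; first by rewrite a0// mulr0 mul0r.
rewrite b0 ?mulr0// cardsDS//.
by rewrite ltn_subLR ?subset_leq_card// (leq_trans Kde)// leq_add2r.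
Qed.

Lemma vanish_below_iter_wedge a k :
  vanish_below 2 a -> vanish_below (k * 2) (iter k (wedge a) (ext1 R n)).
Proof.
by move=> a0; elim: k => [K//|k IHk]; rewrite mulSn; exact: vanish_below_wedge.
Qed.

Lemma ext_exp0 a : vanish_below 2 a -> ext_exp a finset.set0 = 1.
Proof.
move=> a0; rewrite sum_ffunE big_ord_recl big1 ?addr0 => [|k _].
  by rewrite scalE ffunE eqxx fact0 invr1 mulr1.
by rewrite scalE (vanish_below_iter_wedge a0) ?mulr0// cards0.
Qed.

Lemma ext_exp2 a K : (0 < n)%N -> vanish_below 2 a -> #|K| = 2 -> ext_exp a K = a K.
Proof.
(* The exponential is a sum over exponents up to [n], so [0 < n] ensures that the exponent 1, which
   carries [a] itself, occurs. *)
move=> n0 a0 K2; have n1 : (1 < n.+1)%N by [].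
rewrite sum_ffunE (bigD1 (Ordinal n1))//= big1 ?addr0 => [|k /eqP k1].
  by rewrite invr1 scale1r wedge1r.
rewrite scalE; have [k0|k0] := posnP k.
  by rewrite k0 ffunE -cards_eq0 K2 mulr0.
rewrite (vanish_below_iter_wedge a0) ?mulr0// K2.
by rewrite -[ltnLHS]mul1n ltn_pmul2r// ltn_neqAle k0 andbT; apply/eqP => k1'; apply/k1/val_inj.
Qed.

Lemma ext_form2_basis (A : 'M[R]_n) : ext_form2 A =
  \sum_(i < n) \sum_(j < n | (i < j)%N) A i j *: ext_basis [set i; j]%SET.
Proof.
apply: eq_bigr => i _; apply: eq_bigr => j ij; congr (_ *: _).
rewrite !ext_cov_delta wedge_basis finset.disjoints1 inE.
have -> : i != j by apply: contraTneq ij => ->; rewrite ltnn.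
rewrite wedge_sign1 (_ : [set k in _ | _]%SET = finset.set0) ?cards0 ?scale1r//.
apply/setP => k; rewrite !inE; apply/negP => /andP[/eqP ->].
by rewrite ltnNge ltnW.
Qed.

Lemma vanish_below_ext_form2 (A : 'M[R]_n) : vanish_below 2 (ext_form2 A).
Proof.
move=> K K2; rewrite ext_form2_basis sum_ffunE big1// => i _.
rewrite sum_ffunE big1// => j ij; rewrite scalE ffunE; case: eqP => [KE|]; last by rewrite mulr0.
by move: K2; rewrite KE cards2 (_ : i != j)//; apply: contraTneq ij => ->; rewrite ltnn.
Qed.

Lemma ext_form2_coef (A : 'M[R]_n) (i j : 'I_n) : (i < j)%N -> ext_form2 A [set i; j]%SET = A i j.
Proof.
move=> ij; rewrite ext_form2_basis sum_ffunE (bigD1 i)//= [X in _ + X]big1 ?addr0.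
  rewrite sum_ffunE (bigD1 j)//= big1 ?addr0.
    by rewrite scalE ffunE eqxx mulr1.
  move=> k /andP[ik kj]; rewrite scalE ffunE; case: eqP => [/setP/(_ j)|]; last by rewrite mulr0.
  rewrite !inE eqxx orbT => /esym/orP[/eqP ji|/eqP jk].
    by move: ij; rewrite ji ltnn.
  by move: kj; rewrite jk eqxx.
move=> k ki; rewrite sum_ffunE big1// => l kl; rewrite scalE ffunE.
case: eqP => [E|]; last by rewrite mulr0.
have : i \in [set k; l]%SET by rewrite -E finset.set21.
have : j \in [set k; l]%SET by rewrite -E finset.set22.
rewrite !inE [i == k]eq_sym (negPf ki) /= => /orP[/eqP jk|/eqP jl] /eqP il.
  by move: ij; rewrite il jk => lk; have := ltn_trans lk kl; rewrite ltnn.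
by move: ij; rewrite il jl ltnn.
Qed.

(** This coefficient shows that the exponential is never 0, whatever [A] is. *)
Lemma ext_exp_form2_0 (A : 'M[R]_n) : ext_exp (- ext_form2 A) finset.set0 = 1.
Proof.
by apply: ext_exp0 => K /vanish_below_ext_form2; rewrite ffunE => ->; rewrite oppr0.
Qed.

Lemma ext_exp_form2_2 (A : 'M[R]_n) (i j : 'I_n) : (i < j)%N ->
  ext_exp (- ext_form2 A) [set i; j]%SET = - A i j.
Proof.
move=> ij; rewrite ext_exp2 ?(leq_ltn_trans _ (ltn_ord i))//.
- by rewrite ffunE ext_form2_coef.
- by move=> K /vanish_below_ext_form2; rewrite ffunE => ->; rewrite oppr0.
- by rewrite cards2 (_ : i != j)//; apply: contraTneq ij => ->; rewrite ltnn.
Qed.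

End ExteriorAlgebra.

(** * Smooth dependence of exterior operations on a parameter *)

Section SmoothExterior.
Variables (R : realType) (n m : nat) (U : set 'rV[R]_m) (oU : open U).
Local Notation ext := {ffun {set 'I_n} -> R}.
Implicit Types a b : 'rV[R]_m -> ext.

Lemma smooth_on_wedge a b :
  (forall K, smooth_on U (fun x => a x K)) -> (forall K, smooth_on U (fun x => b x K)) ->
  forall K, smooth_on U (fun x => wedge (a x) (b x) K).
Proof.
move=> aU bU K; apply: (eq_smooth_on oU) => [x _|]; first by rewrite ffunE.
apply: smooth_on_sum => // I _; apply: smooth_onM => //.
by apply: smooth_onM => //; exact: smooth_on_cst.
Qed.

Lemma smooth_on_ext_exp a : (forall K, smooth_on U (fun x => a x K)) ->
  forall K, smooth_on U (fun x => ext_exp (a x) K).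
Proof.
move=> aU K; apply: (@eq_smooth_on _ _ _ oU (fun x => \sum_(k < n.+1)
    (k`!%:R)^-1 * iter k (wedge (a x)) (ext1 R n) K)) => [x _|].
  by rewrite sum_ffunE; apply: eq_bigr => k _; rewrite ffunE.
apply: smooth_on_sum => // k _; apply: smooth_onM => //; first exact: smooth_on_cst.
elim: (k : nat) K => [|l IHl] K /=; first exact: smooth_on_cst.
apply: smooth_on_wedge; [exact: aU|exact: IHl].
Qed.

Lemma smooth_on_ext_form2 (A : 'rV[R]_m -> 'M[R]_n) :
  (forall i j, smooth_on U (fun x => A x i j)) ->
  forall K, smooth_on U (fun x => ext_form2 (A x) K).
Proof.
move=> AU K; apply: (@eq_smooth_on _ _ _ oU (fun x => \sum_(i < n) \sum_(j < n | (i < j)%N)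
   A x i j * wedge (ext_cov (delta_mx 0 i)) (ext_cov (delta_mx 0 j)) K)) => [x _|].
  rewrite sum_ffunE; apply: eq_bigr => i _; rewrite sum_ffunE; apply: eq_bigr => j _.
  by rewrite [RHS]ffunE.
apply: smooth_on_sum => // i _; apply: smooth_on_sum => // j _.
by apply: smooth_onM => //; exact: smooth_on_cst.
Qed.

End SmoothExterior.

(** * Coordinate frames *)

Section Frames.
Variables (R : realType) (n : nat) (M : smooth_manifold R n).
Implicit Types (c d : chart R n M) (p : M) (W : set M) (w : M -> 'M[R]_n).

Lemma chart_at_atlas p : atlas (chart_at p).
Proof. by rewrite /chart_at; case: cid => c []. Qed.

Lemma chart_at_dom p : cdom (chart_at p) p.
Proof. by rewrite /chart_at; case: cid => c []. Qed.

Lemma open_cmap_image c W : open W -> open (cmap c @` (W `&` cdom c)).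
Proof.
move=> oW; rewrite openE => _ [p [Wp cp] <-]; rewrite /interior.
have cx : (cmap c @` cdom c) (cmap c p) by exists p.
have Wn : nbhs (cinv c (cmap c p)) (W `&` cdom c).
  by rewrite cmapK//; apply: open_nbhs_nbhs; split=> //; apply: openI => //; exact: cdom_open.
(* [cinv] is meaningful only on the image of [cdom], so the neighbourhood given by its continuity is
   cut down to that image. *)
have /(_ _ Wn) := cinv_continuous cx; rewrite /= nbhs_simpl /=.
apply: filterS2 (open_nbhs_nbhs (conj (@cimg_open _ _ _ c) cx)) => y [q cq <-] /=.
by rewrite cmapK// => Wq; exists q.
Qed.

Lemma cmap_image_near c W p : open W -> W p -> cdom c p ->
  \forall x \near cmap c p, (cmap c @` (W `&` cdom c)) x.
Proof. by move=> oW Wp cp; apply: open_nbhs_nbhs; split; [exact: open_cmap_image | exists p]. Qed.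

Lemma transition_differentiable c d p : atlas c -> atlas d -> cdom c p -> cdom d p ->
  differentiable (fun x => cmap d (cinv c x)) (cmap c p).
Proof.
move=> ca da cp dp; apply: differentiable_row => j.
by apply: (smooth_on_differentiable (atlas_compat ca da j)); exists p.
Qed.

(** The two factors are the Jacobians of the transition from [c] to [chart_at p] and of its inverse;
    the chain rule applies because the composite is the identity near [cmap c p]. *)
Lemma frameK c p : atlas c -> cdom c p -> frame c p *m (coframe c p)^T = 1%:M.
Proof.
move=> ca cp; have da := chart_at_atlas p; have dp := chart_at_dom p.
rewrite /frame /coframe trmxK; set d := chart_at p in da dp *.
pose T x := cmap d (cinv c x); pose S y := cmap c (cinv d y).
have dT : differentiable T (cmap c p) by exact: transition_differentiable.
have Tp : T (cmap c p) = cmap d p by rewrite /T cmapK.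
have dS : differentiable S (T (cmap c p)) by rewrite Tp; exact: transition_differentiable.
apply/row_matrixP => i; rewrite !rowE mulmx1 mulmxA -Tp -!deriveEjacobian//.
rewrite !deriveE// -[LHS]/(('d S (T (cmap c p)) \o 'd T (cmap c p)) _) -diff_comp//.
rewrite -deriveE; last exact: differentiable_comp.
rewrite (@near_eq_derive _ _ _ _ id) ?derive_id//.
apply: filterS (cmap_image_near (@cdom_open _ _ _ d) dp cp) => _ [q [dq cq] <-] /=.
by rewrite /S /T !cmapK.
Qed.

Lemma coframeK c p : atlas c -> cdom c p -> (coframe c p)^T *m frame c p = 1%:M.
Proof. by move=> ca cp; apply: mulmx1C; exact: frameK. Qed.

Lemma trmx_frameK c p : atlas c -> cdom c p -> (frame c p)^T *m coframe c p = 1%:M.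
Proof.
by move=> ca cp; rewrite -[RHS]trmx1 -(coframeK ca cp) trmx_mul trmxK.
Qed.

Lemma trmx_coframeK c p : atlas c -> cdom c p -> coframe c p *m (frame c p)^T = 1%:M.
Proof.
by move=> ca cp; rewrite -[RHS]trmx1 -(frameK ca cp) trmx_mul trmxK.
Qed.

Lemma form2_inE c w p : cdom c p ->
  form2_in c w (cmap c p) = frame c p *m w p *m (frame c p)^T.
Proof. by move=> cp; rewrite /form2_in cmapK. Qed.

Lemma form2_inK c w p : atlas c -> cdom c p ->
  (coframe c p)^T *m form2_in c w (cmap c p) *m coframe c p = w p.
Proof.
move=> ca cp; rewrite form2_inE// !mulmxA coframeK// mul1mx -mulmxA.
by rewrite trmx_frameK// mulmx1.
Qed.

Lemma is_skew_congr (P A : 'M[R]_n) : is_skew A -> is_skew (P *m A *m P^T).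
Proof. by move=> skA; rewrite /is_skew !trmx_mul trmxK skA mulNmx mulmxN mulmxA. Qed.

Lemma form2_in_skew c w p : is_skew (w p) -> cdom c p -> is_skew (form2_in c w (cmap c p)).
Proof. by move=> skw cp; rewrite form2_inE//; exact: is_skew_congr. Qed.

(** * The metric in a chart and smoothness of [f] *)

Section Metric.
Variable g : M -> {ffun {set 'I_n} -> R} -> {ffun {set 'I_n} -> R} -> R.
Hypothesis g_metric : smooth_metric g.

Definition gram c (x : 'rV[R]_n) (I J : {set 'I_n}) : R :=
  g (cinv c x) (ext_coframe c I (cinv c x)) (ext_coframe c J (cinv c x)).

Lemma metric_suml p (T : Type) (r : seq T) (k : T -> R)
    (a : T -> {ffun {set 'I_n} -> R}) b :
  g p (\sum_(i <- r) k i *: a i) b = \sum_(i <- r) k i * g p (a i) b.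
Proof.
have [gl _ _ _] := g_metric; elim: r => [|i r IHr]; last by rewrite !big_cons gl IHr.
(* The empty sum: linearity at [-1 *: 0 + 0] forces [g p 0 b = 0]. *)
rewrite !big_nil; have := gl p (-1) 0 0 b.
by rewrite scaler0 addr0 mulN1r addNr.
Qed.

Lemma metric_pull c p (a b : {ffun {set 'I_n} -> R}) : cdom c p ->
  g p (pull (coframe c p) a) (pull (coframe c p) b) =
  \sum_I \sum_J a I * b J * gram c (cmap c p) I J.
Proof.
move=> cp; have [_ gC _ _] := g_metric.
rewrite metric_suml; apply: eq_bigr => I _; rewrite gC metric_suml mulr_sumr.
by apply: eq_bigr => J _; rewrite gC mulrA /gram cmapK.
Qed.

Lemma ext_exp_form2_pull c w p : atlas c -> cdom c p -> is_skew (w p) ->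
  ext_exp (- ext_form2 (w p)) =
  pull (coframe c p) (ext_exp (- ext_form2 (form2_in c w (cmap c p)))).
Proof.
move=> ca cp skw; rewrite pull_ext_exp linearN /= pull_ext_form2 ?form2_inK//.
exact: form2_in_skew.
Qed.

Lemma metric_ext_exp_gt0 p (A : 'M[R]_n) :
  0 < g p (ext_exp (- ext_form2 A)) (ext_exp (- ext_form2 A)).
Proof.
have [_ _ gp _] := g_metric; apply: gp; apply/eqP => /ffunP/(_ finset.set0).
by rewrite ext_exp_form2_0 ffunE => /eqP; rewrite oner_eq0.
Qed.

Lemma inv_norm_exp_gt0 w p : 0 < inv_norm_exp w g p.
Proof. by rewrite invr_gt0 sqrtr_gt0 metric_ext_exp_gt0. Qed.

Lemma smooth_inv_norm_exp W w : open W -> is_form2 W w -> smooth_fun W (inv_norm_exp w g).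
Proof.
move=> oW [skw sw] c ca; have oU := @open_cmap_image c _ oW.
have [_ _ _ gs] := g_metric.
set U := cmap c @` _ in oU *.
apply: (@eq_smooth_on _ _ _ oU (fun x => (Num.sqrt (g (cinv c x)
  (ext_exp (- ext_form2 (w (cinv c x)))) (ext_exp (- ext_form2 (w (cinv c x))))))^-1)) => //.
apply: smooth_onV => // [x _|].
  by rewrite lt0r_neq0 // sqrtr_gt0 metric_ext_exp_gt0.
apply: smooth_on_sqrt => // [x _|]; first exact: metric_ext_exp_gt0.
(* The squared norm is rewritten with the coefficients in the coframe of [c] and the Gram functions
   of [g]: each of these is smooth in [x], while the presentation of [w] itself may jump. *)
pose e x := ext_exp (- ext_form2 (form2_in c w x)).
apply: (@eq_smooth_on _ _ _ oU (fun x => \sum_I \sum_J e x I * e x J * gram c x I J)).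
  move=> _ /set_mem[p [Wp cp] <-]; rewrite cmapK//.
  by rewrite (ext_exp_form2_pull ca cp) ?metric_pull//; exact: skw.
have es K : smooth_on U (fun x => e x K).
  apply: smooth_on_ext_exp => // {}K.
  apply: (@eq_smooth_on _ _ _ oU (fun x => - ext_form2 (form2_in c w x) K)).
    by move=> x _; rewrite [RHS]ffunE.
  by apply: smooth_onN => //; apply: smooth_on_ext_form2 => //; exact: sw.
apply: smooth_on_sum => // I _; apply: smooth_on_sum => // J _.
apply: smooth_onM => //; first exact: smooth_onM.
by apply: smooth_on_sub (gs c ca I J) => _ [p [_ cp] <-]; exists p.
Qed.

Lemma smooth_fun_continuous W (f : M -> R) p : open W -> smooth_fun W f -> W p ->
  {for p, continuous f}.
Proof.
move=> oW sf Wp; pose c := chart_at p.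
have ca : atlas c := chart_at_atlas p; have cp : cdom c p := chart_at_dom p.
have Ux : (cmap c @` (W `&` cdom c)) (cmap c p) by exists p.
have fc := smooth_on_continuous (sf c ca) Ux.
have fcc : {for p, continuous ((f \o cinv c) \o cmap c)}.
  exact: continuous_comp (cmap_continuous cp) fc.
have fE : ((f \o cinv c) \o cmap c) p = f p by rewrite /= cmapK.
suff : f @ p --> ((f \o cinv c) \o cmap c) p by rewrite fE.
apply: cvg_trans fcc; apply: near_eq_cvg.
have := open_nbhs_nbhs (conj (@cdom_open _ _ _ c) cp).
by apply: filterS => q cq; rewrite /= cmapK.
Qed.

End Metric.
End Frames.

(** * Norm estimates near a point *)

Section LowerBounds.
Variables (R : realType) (n k : nat).

(** Positivity is known at [x0] only. It spreads by continuity to nearby [x], uniformly over the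
    compact unit sphere of [S], and homogeneity extends the bound to [S]. The closed cone [S] allows
    for norms that are controlled on skew matrices alone. *)
Lemma homogeneous_lower_bound (x0 : 'rV[R]_n) (U : set 'rV[R]_n) (S : set 'rV[R]_k)
    (q : 'rV[R]_n * 'rV[R]_k -> R) :
  nbhs x0 U -> closed S -> S 0 -> (forall t v, S v -> S (t *: v)) ->
  {within [set z | U z.1 /\ S z.2], continuous q} ->
  (forall x t v, U x -> S v -> q (x, t *: v) = `|t| * q (x, v)) ->
  (forall v, S v -> q (x0, v) <= 0 -> v = 0) ->
  exists2 e : R, 0 < e & \forall x \near x0, forall v, S v -> e * `|v| <= q (x, v).
Proof.
move=> Ux0 cS S0 SZ qc qZ q0.
pose K := S `&` [set v : 'rV[R]_k | `|v| = 1].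
have cK : compact K.
  apply: bounded_closed_compact.
    exists 1; split; first exact: num_real.
    by move=> r r1 v [_ /= ->]; exact: ltW.
  apply: closedI => //.
  have -> : [set v : 'rV[R]_k | `|v| = 1] = (@Num.norm R 'rV[R]_k) @^-1` [set 1] by [].
  by apply: closed_comp; [move=> v _; exact: norm_continuous | exact: closed_eq].
(* Letting the bound [e] tend to [0] from the right together with [x] to [x0] makes compactness
   choose one [e] for all unit vectors. Near each of them half of the value of [q] at [x0] serves as
   a threshold. *)
have /compact_near_coveringP/(_ ('rV[R]_n * R)%type
  (filter_prod (nbhs x0) (at_right (0:R))) (fun i v => U i.1 -> S v -> i.2 <= q (i.1, v))) := cK.
case.
  move=> v [Sv v1]; have Ux := nbhs_singleton Ux0.
  have qv : 0 < q (x0, v).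
    rewrite ltNge; apply/negP => /(q0 _ Sv) v0; move: v1; rewrite v0 /= normr0 => /eqP.
    by rewrite eq_sym oner_eq0.
  have /subspace_continuousP/(_ (x0, v) (conj Ux Sv)) := qc.
  move=> /(cvgr_gt _)/(_ (q (x0, v) / 2)); rewrite ltr_pdivrMr// ltr_pMr// ltr1n => /(_ isT).
  move=> [[A B] /= [xA vB] AB].
  exists (B, [set i | A i.1 /\ i.2 < q (x0, v) / 2]) => /=.
    split=> //; exists (A, [set e | e < q (x0, v) / 2]) => /=; last by move=> [].
    by split=> //; apply: nbhs_right_lt; rewrite divr_gt0.
  move=> [v' [x e]] /= [Bv' [Ax eq]] Ux' Sv'.
  exact/ltW/(lt_trans eq)/(AB (x, v')).
move=> [A B] /= [xA eB] AB.
have [e [/= Be e0]] : exists e, B e /\ 0 < e.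
  apply: (@filter_ex _ (at_right (0:R))); apply: filterI => //; exact: nbhs_right_gt.
exists e => //; apply: filterS2 xA Ux0 => x Ax Ux v Sv.
have [->|v0] := eqVneq v 0.
  by rewrite normr0 mulr0 -(scale0r (0 : 'rV[R]_k)) qZ// normr0 mul0r.
have nv0 : `|v| != 0 by rewrite normr_eq0.
have uS : S (`|v|^-1 *: v) by exact: SZ.
have uK : K (`|v|^-1 *: v).
  by split=> //=; rewrite normrZ normfV normr_id mulVf.
have := AB (x, e) (conj Ax Be) _ uK Ux uS => /=.
by rewrite qZ// normfV normr_id mulrC ler_pdivlMr// normr_gt0.
Qed.

End LowerBounds.

Lemma linear_rV_continuous (R : realType) (k : nat) (V : normedModType R)
  (f : {linear 'rV[R]_k -> V}) : continuous f.
Proof.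
move=> v; apply: differentiable_continuous.
have -> : (f : 'rV[R]_k -> V) = \sum_j (fun u : 'rV[R]_k => u 0 j *: f (delta_mx 0 j)).
  apply/funext => u; rewrite fct_sumE {1}[u]row_sum_delta linear_sum.
  by apply: eq_bigr => j _; rewrite linearZ.
by apply: differentiable_sum => j; apply: differentiableZl; exact: differentiable_coord.
Qed.

Lemma ler_coord_norm (R : realType) (k l : nat) (A : 'M[R]_(k, l)) i j : `|A i j| <= `|A|.
Proof. by rewrite [leRHS]mx_normrE (le_bigmax _ (fun i => `|A i.1 i.2|) (i, j)). Qed.

Lemma continuous_at_sum (R : realType) (T : topologicalType) (x : T) (I : Type) (r : seq I)
    (F : I -> T -> R) :
  (forall i, {for x, continuous (F i)}) ->
  {for x, continuous (fun y => \sum_(i <- r) F i y)}.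
Proof.
move=> Fc; elim: r => [|i r IHr].
  by rewrite (_ : (fun _ => _) = fun=> 0); [exact: cvg_cst | apply/funext => y; rewrite big_nil].
rewrite (_ : (fun _ => _) = fun y => F i y + \sum_(j <- r) F j y).
  exact: (@cvgD _ R^o _ _ _ _ _ _ _ (Fc i) IHr).
by apply/funext => y; rewrite big_cons.
Qed.

(** * Uniform comparison of fibre norms with coordinate coefficients *)

Section NormBounds.
Variables (R : realType) (n : nat) (M : smooth_manifold R n).
Variables (m : M) (c : chart R n M).
Hypotheses (ca : atlas c) (cm : cdom c m).

Let img_nbhs : nbhs (cmap c m) (cmap c @` cdom c).
Proof. by apply: open_nbhs_nbhs; split; [exact: cimg_open | exists m]. Qed.

Lemma near_cmap (P : set 'rV[R]_n) : (\forall x \near cmap c m, P x) ->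
  \forall p \near m, cdom c p /\ P (cmap c p).
Proof.
move=> Pn; apply: filterI; last exact: (cmap_continuous cm).
by apply: open_nbhs_nbhs; split=> //; exact: cdom_open.
Qed.

Lemma metric_norm_lower_bound g : smooth_metric (M := M) g ->
  exists2 e : R, 0 < e & \forall p \near m, cdom c p /\
    forall (a : {ffun {set 'I_n} -> R}) I, e * `|a I| <= metric_norm g p (pull (coframe c p) a).
Proof.
move=> g_metric; pose k := #|{set 'I_n}|.
(* The metric norm in the chart, with the coefficients of a form listed as one row vector to fit
   [homogeneous_lower_bound]. *)
pose q (z : 'rV[R]_n * 'rV[R]_k) := Num.sqrt (\sum_I \sum_J
  z.2 0 (enum_rank I) * z.2 0 (enum_rank J) * gram g c z.1 I J).
pose ext_of (v : 'rV[R]_k) : {ffun {set 'I_n} -> R} := [ffun I => v 0 (enum_rank I)].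
have qE p v : cdom c p -> q (cmap c p, v) = metric_norm g p (pull (coframe c p) (ext_of v)).
  move=> cp; rewrite /metric_norm metric_pull//; congr Num.sqrt.
  by apply: eq_bigr => I _; apply: eq_bigr => J _; rewrite !ffunE.
have [_ _ gp gs] := g_metric.
have [|||||||e e0 eq] := @homogeneous_lower_bound R n k (cmap c m) (cmap c @` cdom c) setT q.
- exact: img_nbhs.
- exact: closedT.
- by [].
- by [].
- apply: continuous_in_subspaceT => -[x v] /set_mem /= [Ux _].
  apply: (@continuous_comp _ _ _ _ (@Num.sqrt R)); last exact: sqrt_continuous.
  apply: continuous_at_sum => I; apply: continuous_at_sum => J.
  have vc (K : {set 'I_n}) :
      {for (x, v), continuous (fun z : 'rV[R]_n * 'rV[R]_k => z.2 0 (enum_rank K))}.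
    by apply: (@continuous_comp _ _ _ snd (fun u : 'rV[R]_k => u 0 (enum_rank K)));
      [exact: cvg_snd | exact: coord_continuous].
  apply: cvgM; first by apply: cvgM; exact: vc.
  apply: (@continuous_comp _ _ _ fst (fun y => gram g c y I J)); first exact: cvg_fst.
  exact: smooth_on_continuous (gs c ca I J) Ux.
- move=> x t v Ux _; rewrite /q /= -sqrtr_sqr -sqrtrM ?sqr_ge0//; congr Num.sqrt.
  rewrite mulr_sumr; apply: eq_bigr => I _; rewrite mulr_sumr; apply: eq_bigr => J _.
  by rewrite !mxE expr2 mulrACA !mulrA.
- move=> v _; rewrite qE// /metric_norm => qv.
  have /eqP pv0 : pull (coframe c m) (ext_of v) == 0.
    apply: contraTT qv => /gp; rewrite -ltNge sqrtr_gt0; exact.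
  have /ffunP v0 := pull_eq0 (trmx_coframeK ca cm) pv0.
  by apply/rowP => i; have := v0 (enum_val i); rewrite !ffunE enum_valK mxE.
exists e => //; apply: filterS (near_cmap eq) => p [cp Hp]; split=> // a I.
pose v : 'rV[R]_k := \row_i a (enum_val i).
have va : ext_of v = a by apply/ffunP => J; rewrite ffunE mxE enum_rankK.
rewrite -va -qE//; apply: le_trans (Hp v Logic.I).
rewrite ler_pM2l// ffunE; exact: ler_coord_norm.
Qed.

(** The triangle inequality for [A] and [- A] gives [0 <= 2 N p A]. *)
Lemma form2_norm_ge0 N p (A : 'M[R]_n) : form2_norm (M := M) N -> is_skew A -> 0 <= N p A.
Proof.
move=> [_ NZ ND _] skA.
have skNA : is_skew (- A) by rewrite /is_skew linearN /= skA.
have N0 : N p 0 = 0 by rewrite -(scale0r A) NZ// normr0 mul0r.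
have NN : N p (- A) = N p A by rewrite -scaleN1r NZ// normrN normr1 mul1r.
have := ND p _ _ skA skNA; rewrite subrr N0 NN -mulr2n.
by rewrite -mulr_natl pmulr_rge0.
Qed.

Lemma form2_norm_lower_bound N : form2_norm (M := M) N ->
  exists2 e : R, 0 < e & \forall p \near m, cdom c p /\
    forall B : 'M[R]_n, is_skew B -> forall i j,
      e * `|B i j| <= N p ((coframe c p)^T *m B *m coframe c p).
Proof.
move=> Nn; have [N0 NZ _ Nc] := Nn; pose P p B := (coframe c p)^T *m B *m coframe c p.
have skP p B : is_skew B -> is_skew (P p B).
  by move=> skB; have := is_skew_congr (coframe c p)^T skB; rewrite trmxK.
(* [N] behaves as a norm on skew matrices only, so the bound is sought on their closed cone,
   flattened to row vectors. *)
pose S := [set v : 'rV[R]_(n * n) | is_skew (vec_mx v)].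
pose q (z : 'rV[R]_n * 'rV[R]_(n * n)) := N (cinv c z.1) (P (cinv c z.1) (vec_mx z.2)).
have [|||||||e e0 eq] := @homogeneous_lower_bound R n _ (cmap c m) (cmap c @` cdom c) S q.
- exact: img_nbhs.
- have -> : S = (fun v => trmx (vec_mx v) + vec_mx v : 'M[R]_n) @^-1` [set 0].
    apply/funext => v; apply/propext; rewrite /S /is_skew /=; split=> [->|/eqP].
      by rewrite addNr.
    by rewrite addr_eq0 => /eqP.
  apply: closed_comp => [v _|].
    apply: (@continuousD _ _ _ (trmx \o vec_mx) vec_mx v).
      exact: (linear_rV_continuous (f := (trmx \o vec_mx))).
    exact: linear_rV_continuous.
  exact: accessible_closed_set1 (hausdorff_accessible (@norm_hausdorff _ _)) _.
- by rewrite /S /is_skew /= !linear0.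
- move=> t v; rewrite /S /is_skew /= linearZ /= => skv.
  by rewrite linearZ /= skv scalerN.
- apply/subspace_continuousP => -[x v] /= [Ux Sv].
  have /subspace_continuousP/(_ (x, vec_mx v) (conj Ux Sv)) Ncx := Nc c ca.
  pose h (z : 'rV[R]_n * 'rV[R]_(n * n)) := (z.1, vec_mx z.2 : 'M[R]_n).
  have hc : h @ nbhs (x, v) --> (x, vec_mx v).
    have vc : {for (x, v), continuous
        (fun z : 'rV[R]_n * 'rV[R]_(n * n) => vec_mx z.2 : 'M[R]_n)}.
      apply: (@continuous_comp _ _ _ snd (fun u => vec_mx u : 'M[R]_n)); first exact: cvg_snd.
      exact: linear_rV_continuous.
    exact: (cvg_pair cvg_fst vc).
  by move=> W /Ncx /hc; apply: (@filterS _ (nbhs (x, v))) => z Wz Dz; exact: Wz.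
- move=> x t v Ux Sv; rewrite /q /= -NZ ?linearZ //=; last exact: skP.
  by rewrite /P -scalemxAr -scalemxAl.
- move=> v Sv; rewrite /q /= cmapK// => Nv.
  have PmE : P m (vec_mx v) = 0.
    apply: (N0 m _ (skP m _ Sv)); apply/eqP; rewrite eq_le Nv.
    by apply: form2_norm_ge0 => //; exact: skP.
  have : vec_mx v = frame c m *m P m (vec_mx v) *m (frame c m)^T :> 'M[R]_n.
    by rewrite /P !mulmxA frameK// mul1mx -mulmxA trmx_coframeK// mulmx1.
  by rewrite PmE mulmx0 mul0mx => v0; rewrite -[v]vec_mxK v0 linear0.
exists e => //; apply: filterS (near_cmap eq) => p [cp Hp]; split=> // B skB i j.
have := Hp (mxvec B); rewrite /S /q /= cmapK// mxvecK => /(_ skB); apply: le_trans.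
by rewrite ler_pM2l// -mxvecE; exact: ler_coord_norm.
Qed.

End NormBounds.

(** * Divergence of a matrix quotient at a singular denominator *)

Section BlowUp.
Variables (R : realType) (n : nat) (X A B : 'rV[R]_n -> 'M[R]_n) (x0 : 'rV[R]_n).
Variable Q : set 'rV[R]_n.
Hypotheses (Xc : forall i j, {for x0, continuous (fun x => X x i j)})
  (Ac : forall i j, {for x0, continuous (fun x => A x i j)}).
Hypotheses (XA_free : row_free (row_mx (X x0) (A x0))) (X_sing : X x0 \notin unitmx).
Hypothesis ABX : \forall x \near x0, Q x -> A x = X x *m B x.

(* A left null vector [t] of [X x0] has [t A x0 <> 0], while [t A = (t X) B]
   with [t X] tending to [0]. *)
Lemma quotient_blows_up (C : R) :
  \forall x \near x0, Q x -> exists i j, C < `|B x i j|.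
Proof.
have [t t0 tX] : exists2 t : 'rV[R]_n, t != 0 & t *m X x0 = 0.
  move: X_sing; rewrite -row_free_unit -kermx_eq0 => /rowV0Pn[t].
  by rewrite sub_kermx => /eqP tX t0; exists t.
have [j tA] : exists j, (t *m A x0) 0 j != 0.
  apply/existsP; apply: contraNT t0 => /existsPn tA; apply/eqP.
  apply: (row_free_inj XA_free); rewrite mul_mx_row mul0mx tX.
  rewrite [t *m A x0](_ : _ = 0) ?row_mx0//.
  by apply/rowP => j; rewrite [RHS]mxE; apply/eqP; have := tA j; rewrite negbK.
(* If all entries of [B x] were at most [C] in absolute value, expanding [t A = (t X) B] in column
   [j] would give [phi x <= 0]; but [phi] is positive at [x0], hence nearby. *)
pose phi x := `|(t *m A x) 0 j| - C * \sum_i `|(t *m X x) 0 i|.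
have tc (Y : 'rV[R]_n -> 'M[R]_n) i : (forall k, {for x0, continuous (fun x => Y x k i)}) ->
    {for x0, continuous (fun x => (t *m Y x) 0 i)}.
  move=> Yc; rewrite (_ : (fun x => _) = fun x => \sum_k t 0 k * Y x k i).
    apply: continuous_at_sum => k; apply: (@continuousM _ _ (fun=> t 0 k)); first exact: (@cst_continuous _ _ (t 0 k) x0).
    exact: Yc.
  by apply/funext => x; rewrite mxE.
have nc (f : 'rV[R]_n -> R) : {for x0, continuous f} -> {for x0, continuous (fun x => `|f x|)}.
  by move=> fc; apply: (@continuous_comp _ _ _ f Num.norm) => //; exact: norm_continuous.
have phic : {for x0, continuous phi}.
  apply: (@continuousB _ R^o _ (fun x => `|(t *m A x) 0 j|)); first exact/nc/tc.
  apply: (@continuousM _ _ (fun=> C)); first exact: (@cst_continuous _ _ C x0).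
  by apply: continuous_at_sum => i; apply/nc/tc.
have phi0 : 0 < phi x0.
  rewrite /phi tX [X in _ * X]big1 ?mulr0 ?subr0 ?normr_gt0// => i _.
  by rewrite mxE normr0.
have phin : \forall x \near x0, 0 < phi x by exact: (cvgr_gt _ phic).
apply: filterS2 ABX phin => x AXB phix Qx.
apply: contrapT => /forallNP BC; move: phix; rewrite ltNge => /negP; apply.
rewrite subr_le0 AXB// mulmxA mxE; apply: le_trans (ler_norm_sum _ _ _) _.
rewrite mulr_sumr; apply: ler_sum => i _; rewrite normrM mulrC ler_wpM2r//.
by have /forallNP/(_ j)/negP := BC i; rewrite -leNgt.
Qed.

End BlowUp.

(** * Dirac structures containing a graph *)

Section Graph.
Variables (R : realType) (n : nat) (M : smooth_manifold R n).
Variables (W : set M) (w : M -> 'M[R]_n).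
Hypotheses (oW : open W) (w_form : is_form2 W w).

(** Over [W] the graph is closed because [w] is continuous in charts. Hence taking the closure adds
    nothing to the fibres over regular points. *)
Lemma gtangent_open_graphC :
  gtangent_open [set e : gtangent M | W (gbase e) /\ (gval e).2 <> (gval e).1 *m w (gbase e)].
Proof.
move=> c ca; rewrite openE => z [[p cp pz] [/= Wp zw]]; rewrite /interior.
rewrite -pz cmapK// in Wp zw.
have [j zj] : exists j, z.2.2 0 j != (z.2.1 *m form2_in c w z.1) 0 j.
  apply/existsP; apply: contrapT => /negP/existsPn zE; apply: zw.
  have -> : z.2.2 = z.2.1 *m form2_in c w z.1.
    by apply/rowP => j; apply/eqP; have := zE j; rewrite negbK.
  by rewrite -pz form2_inE// !mulmxA -!mulmxA trmx_frameK// mulmx1 !mulmxA.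
(* Being off the graph is witnessed by one coordinate [j]; the defect [phi] in that coordinate is
   continuous and stays nonzero near [z]. *)
pose phi1 (y : 'rV[R]_n * ('rV[R]_n * 'rV[R]_n)) := y.2.2 0 j.
pose phi2 (y : 'rV[R]_n * ('rV[R]_n * 'rV[R]_n)) :=
  \sum_i y.2.1 0 i * form2_in c w y.1 i j.
pose phi y := phi1 y - phi2 y.
have z1 : (cmap c @` (W `&` cdom c)) z.1 by exists p.
have phic : {for z, continuous phi}.
  have vc (f : 'rV[R]_n * ('rV[R]_n * 'rV[R]_n) -> 'rV[R]_n) i : continuous f ->
      {for z, continuous (fun y => f y 0 i)}.
    by move=> fc; apply: (@continuous_comp _ _ _ f (fun u : 'rV[R]_n => u 0 i));
      [exact: fc | exact: coord_continuous].
  have phi1c : {for z, continuous phi1}.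
    by apply: (vc (fun y => y.2.2)) => y; apply: (@continuous_comp _ _ _ snd snd); exact: cvg_snd.
  have phi2c : {for z, continuous phi2}.
    apply: continuous_at_sum => i; apply: (@continuousM _ _ (fun y : 'rV[R]_n * ('rV[R]_n * 'rV[R]_n) => y.2.1 0 i)).
      apply: (vc (fun y => y.2.1)) => y; apply: (@continuous_comp _ _ _ snd fst).
        exact: cvg_snd.
      exact: cvg_fst.
    apply: (@continuous_comp _ _ _ fst (fun x => form2_in c w x i j)); first exact: cvg_fst.
    by apply: smooth_on_continuous z1; case: w_form => _ /(_ c ca i j).
  exact: (continuousB (V := R^o) phi1c phi2c).
have phiz : \forall y \near z, phi y != 0.
  apply: (cvgr_neq0 _ phic); rewrite /phi subr_eq0; move: zj; by rewrite [X in _ != X]mxE.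
have imgz : \forall y \near z, (cmap c @` (W `&` cdom c)) y.1.
  have fstc : fst @ nbhs z --> z.1 by exact: cvg_fst.
  by apply: (fstc (cmap c @` (W `&` cdom c))); apply: open_nbhs_nbhs; split=> //;
    exact: open_cmap_image.
apply: filterS2 phiz imgz => -[x [u a]] /= phi0 [q [Wq cq] qx]; split; first by exists q.
subst x; rewrite cmapK//; split=> // aE; move: phi0; rewrite /phi /phi1 /phi2 /=.
have -> : a = u *m form2_in c w (cmap c q).
  rewrite form2_inE// !mulmxA -aE -mulmxA trmx_coframeK//.
  by rewrite mulmx1.
by rewrite mxE subrr eqxx.
Qed.

Lemma fiber_closure_graph p e : W p ->
  fiber (closure (graph W w)) p e <-> e.2 = e.1 *m w p.
Proof.
move=> Wp; split=> [cl|ew]; last exact: subset_closure.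
apply: contrapT => ew.
have [e' [[_ e'w] [_ /=]]] : graph W w `&`
    [set e | W (gbase e) /\ (gval e).2 <> (gval e).1 *m w (gbase e)] !=set0.
  by apply: cl; apply: open_nbhs_nbhs; split; [exact: gtangent_open_graphC|].
exact.
Qed.

End Graph.

(** * Matrices of a family of sections *)

Section LocalFrames.
Variables (R : realType) (n : nat) (M : smooth_manifold R n).

Definition vec_mx_of k (s : 'I_k -> M -> 'rV[R]_n * 'rV[R]_n) (q : M) : 'M[R]_(k, n) :=
  \matrix_(i, j) (s i q).1 0 j.

Definition cov_mx_of k (s : 'I_k -> M -> 'rV[R]_n * 'rV[R]_n) (q : M) : 'M[R]_(k, n) :=
  \matrix_(i, j) (s i q).2 0 j.

Lemma sum_sections k (s : 'I_k -> M -> 'rV[R]_n * 'rV[R]_n) q (t : 'I_k -> R) :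
  \sum_i t i *: s i q =
  ((\row_i t i) *m vec_mx_of s q, (\row_i t i) *m cov_mx_of s q).
Proof.
rewrite [LHS]surjective_pairing (big_morph fst (id1 := 0) (op1 := +%R))//.
rewrite (big_morph snd (id1 := 0) (op1 := +%R))//.
by congr pair; apply/rowP => j; rewrite summxE mxE; apply: eq_bigr => i _; rewrite !mxE.
Qed.

Lemma span_sections k (s : 'I_k -> M -> 'rV[R]_n * 'rV[R]_n) q e :
  e \in <<[seq s i q | i <- enum 'I_k]>>%VS <->
  exists t : 'rV[R]_k, e = (t *m vec_mx_of s q, t *m cov_mx_of s q).
Proof.
pose S := [tuple s i q | i < k].
have Si (i : 'I_k) : S`_i = s i q by rewrite -tnth_nth tnth_mktuple.
split=> [/(@coord_span _ _ _ S) ->|[t ->]].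
  under eq_bigr do rewrite Si.
  by rewrite sum_sections; eexists.
have -> : t = \row_i t 0 i by apply/rowP => i; rewrite mxE.
rewrite -sum_sections; apply: memv_suml => i _; apply/memvZ/memv_span.
by apply: map_f; rewrite mem_enum.
Qed.

Lemma row_free_ker0 (k l : nat) (A : 'M[R]_(k, l)) :
  (forall t : 'rV[R]_k, t *m A = 0 -> t = 0) -> row_free A.
Proof.
move=> A0; rewrite -kermx_eq0; apply/rowV0P => t; rewrite sub_kermx => /eqP.
exact: A0.
Qed.

Lemma free_sections k (s : 'I_k -> M -> 'rV[R]_n * 'rV[R]_n) q :
  free [seq s i q | i <- enum 'I_k] ->
  row_free (row_mx (vec_mx_of s q) (cov_mx_of s q)).
Proof.
pose S := [tuple s i q | i < k].
have Si (i : 'I_k) : S`_i = s i q by rewrite -tnth_nth tnth_mktuple.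
move=> /(@freeP _ _ _ S) S0; apply: row_free_ker0 => t.
rewrite mul_mx_row -[0]row_mx0 => /eq_row_mx[tX tA]; apply/rowP => i; rewrite mxE.
apply: (S0 (fun i => t 0 i)); under eq_bigr do rewrite Si.
by rewrite sum_sections (_ : \row_i t 0 i = t) ?tX ?tA//; apply/rowP => j; rewrite mxE.
Qed.

Section ChartFrames.
Variables (k : nat) (s : 'I_k -> M -> 'rV[R]_n * 'rV[R]_n).
Variables (c : chart R n M) (ca : atlas c).

(** For smooth sections this matrix is smooth in [x]; [vec_mx_of] has no such regularity, since its
    columns refer to the chart chosen at each point. *)
Definition vec_mx_in (x : 'rV[R]_n) : 'M[R]_(k, n) :=
  \matrix_(i, j) vec_in c (fst \o s i) x 0 j.

Definition cov_mx_in (x : 'rV[R]_n) : 'M[R]_(k, n) :=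
  \matrix_(i, j) cov_in c (snd \o s i) x 0 j.

Lemma vec_mx_inE q : cdom c q -> vec_mx_in (cmap c q) = vec_mx_of s q *m (coframe c q)^T.
Proof.
move=> cq; apply/matrixP => i j; rewrite mxE /vec_in cmapK// !mxE.
by apply: eq_bigr => l _; rewrite !mxE.
Qed.

Lemma cov_mx_inE q : cdom c q -> cov_mx_in (cmap c q) = cov_mx_of s q *m (frame c q)^T.
Proof.
move=> cq; apply/matrixP => i j; rewrite mxE /cov_in cmapK// !mxE.
by apply: eq_bigr => l _; rewrite !mxE.
Qed.

Lemma vec_mx_inK q : cdom c q -> vec_mx_in (cmap c q) *m frame c q = vec_mx_of s q.
Proof. by move=> cq; rewrite vec_mx_inE// -mulmxA coframeK// mulmx1. Qed.

Lemma cov_mx_inK q : cdom c q -> cov_mx_in (cmap c q) *m coframe c q = cov_mx_of s q.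
Proof. by move=> cq; rewrite cov_mx_inE// -mulmxA trmx_frameK// mulmx1. Qed.

Lemma row_free_in q : cdom c q -> row_free (row_mx (vec_mx_of s q) (cov_mx_of s q)) ->
  row_free (row_mx (vec_mx_in (cmap c q)) (cov_mx_in (cmap c q))).
Proof.
move=> cq XA; apply: row_free_ker0 => t; rewrite mul_mx_row -[0]row_mx0 => /eq_row_mx[tX tA].
apply: (row_free_inj XA); rewrite mul0mx mul_mx_row -vec_mx_inK// -cov_mx_inK// !mulmxA.
by rewrite tX tA !mul0mx row_mx0.
Qed.

End ChartFrames.

Lemma unitmx_vec_mx_in (s : 'I_n -> M -> 'rV[R]_n * 'rV[R]_n) c q : atlas c -> cdom c q ->
  (vec_mx_in s c (cmap c q) \in unitmx) = (vec_mx_of s q \in unitmx).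
Proof.
move=> ca cq; rewrite -(vec_mx_inK s ca cq) unitmx_mul.
by have /mulmx1_unit[-> _] := frameK ca cq; rewrite andbT.
Qed.

Lemma smooth_section_in V k (s : 'I_k -> M -> 'rV[R]_n * 'rV[R]_n) c i j : atlas c ->
  (forall i, smooth_section V (s i)) ->
  smooth_on (cmap c @` (V `&` cdom c)) (fun x => vec_mx_in s c x i j) /\
  smooth_on (cmap c @` (V `&` cdom c)) (fun x => cov_mx_in s c x i j).
Proof.
move=> ca /(_ i c ca j)[vs cs].
have -> : (fun x => vec_mx_in s c x i j) = fun x => vec_in c (fst \o s i) x 0 j.
  by apply/funext => x; rewrite mxE.
have -> // : (fun x => cov_mx_in s c x i j) = fun x => cov_in c (snd \o s i) x 0 j.
by apply/funext => x; rewrite mxE.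
Qed.

End LocalFrames.

(** * Consequences of removability near a singular point *)

Section Removable.
Variables (R : realType) (n : nat) (M : smooth_manifold R n).
Variables (Msing : set M) (Msing_closed : closed Msing) (Msing_codense : dense (~` Msing)).
Variables (w : M -> 'M[R]_n) (w_form : is_form2 (~` Msing) w).

Let oreg : open (~` Msing). Proof. exact: closed_openC. Qed.

(** Indexing by ['I_n] makes both matrices square, so that [X] may be inverted. The third clause is
    isotropy as a matrix identity. *)
Definition lagrangian_frame (V : set M) (s : 'I_n -> M -> 'rV[R]_n * 'rV[R]_n) : Prop :=
  [/\ forall i, smooth_section V (s i),
      forall q, V q -> row_free (row_mx (vec_mx_of s q) (cov_mx_of s q)),
      forall q, V q ->
        vec_mx_of s q *m (cov_mx_of s q)^T + cov_mx_of s q *m (vec_mx_of s q)^T = 0 &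
      forall q, V q -> ~ Msing q -> cov_mx_of s q = vec_mx_of s q *m w q].

Lemma removable_frame m : removable Msing w m ->
  exists V s, [/\ open V, V m & lagrangian_frame V s].
Proof.
move=> [U [oU Um [subb maxi _]]].
have [k [V [s [oV Vm VU ss sV]]]] := subb m Um.
have XwA q : V q -> ~ Msing q -> cov_mx_of s q = vec_mx_of s q *m w q.
  move=> Vq rq; apply/row_matrixP => i; have [_ sL] := sV q Vq.
  have : s i q \in <<[seq s i q | i <- enum 'I_k]>>%VS.
    by apply/memv_span/map_f; rewrite mem_enum.
  move=> /sL /(fiber_closure_graph oreg w_form _ rq) si; rewrite row_mul.
  have -> : row i (cov_mx_of s q) = (s i q).2 by apply/rowP => j; rewrite !mxE.
  by rewrite si; congr (_ *m _); apply/rowP => j; rewrite !mxE.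
have free_s q : V q -> row_free (row_mx (vec_mx_of s q) (cov_mx_of s q)).
  by move=> /sV[fs _]; exact: free_sections.
(* At a regular point of [V] the matrix [[X, A]] is [X [1, w]], so its rank [k] is at most [n]; and
   every tangent vector is the vector part of an element of the fibre, so [X] has rank [n] and
   [n <= k]. *)
have kn : k = n.
  have [q [Vq rq]] : V `&` ~` Msing !=set0 by apply: Msing_codense => //; exists m.
  apply/eqP; rewrite eqn_leq; apply/andP; split.
    have := free_s q Vq; rewrite XwA// /row_free => /eqP <-.
    rewrite -[X in row_mx X _]mulmx1 -mul_mx_row.
    exact: leq_trans (mxrankM_maxl _ _) (rank_leq_col _).
  rewrite -[leqLHS](@mxrank1 R).
  apply: leq_trans (_ : \rank (vec_mx_of s q) <= k)%N; last exact: rank_leq_row.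
  apply/mxrankS/row_subP => i; have [_ sL] := sV q Vq.
  have /(fiber_closure_graph oreg w_form _ rq)/sL/span_sections[t [tX _]] :
    (row i (1%:M : 'M[R]_n), row i 1%:M *m w q).2 =
    (row i (1%:M : 'M[R]_n), row i 1%:M *m w q).1 *m w q by [].
  by rewrite tX submxMl.
subst k; exists V, s; split=> //; split=> // q Vq.
have [iso _] := maxi q (VU q Vq); have [_ sL] := sV q Vq.
have Ls i : fiber (closure (graph (~` Msing) w)) q (s i q).
  by apply/sL/memv_span/map_f; rewrite mem_enum.
apply/matrixP => i j; rewrite !mxE.
have /eqP := iso _ _ (Ls i) (Ls j); rewrite /pairing mulf_eq0 invr_eq0 pnatr_eq0 /= => /eqP ij.
by rewrite -[RHS]ij; congr (_ + _); apply: eq_bigr => l _; rewrite !mxE // mulrC.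
Qed.

Section Frame.
Variables (m : M) (V : set M) (s : 'I_n -> M -> 'rV[R]_n * 'rV[R]_n).
Hypotheses (oV : open V) (Vm : V m) (sV : lagrangian_frame V s).

(** Invertibility of [X] is an open condition, because its determinant in a chart is continuous;
    [X^-1 A] is then defined on a whole neighbourhood of [m]. *)
Lemma form2_extension : vec_mx_of s m \in unitmx ->
  exists (U : set M) (w' : M -> 'M[R]_n),
    [/\ open U, U m, is_form2 (~` Msing `|` U) w' & forall p, ~ Msing p -> w' p = w p].
Proof.
move=> Xm; have [ss _ XA AXw] := sV.
pose U := [set q | V q /\ vec_mx_of s q \in unitmx].
have oU : open U.
  rewrite openE => q [Vq Xq]; rewrite /interior.
  have ca := chart_at_atlas q; have cq := chart_at_dom q; set c := chart_at q in ca cq.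
  have detc : {for cmap c q, continuous (fun x => \det (vec_mx_in s c x))}.
    apply: (@smooth_on_continuous _ _ (cmap c @` (V `&` cdom c))); last by exists q.
    apply: smooth_on_det; first exact: open_cmap_image.
    by move=> i j; case: (smooth_section_in i j ca ss).
  have dq : \det (vec_mx_in s c (cmap c q)) != 0.
    by rewrite -unitfE -unitmxE unitmx_vec_mx_in.
  have detn : \forall x \near cmap c q, \det (vec_mx_in s c x) != 0.
    exact: (cvgr_neq0 _ detc dq).
  have Vn := open_nbhs_nbhs (conj oV Vq).
  apply: filterS2 Vn (near_cmap cq detn) => p Vp [cp dp]; split=> //.
  by rewrite -(unitmx_vec_mx_in _ ca cp) unitmxE unitfE.
(* The two branches agree at regular points of [U], since [A = X w] there; this is why smoothness
   can be checked separately on [U] and on the regular set. *)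
pose w' q := if `[< U q >] then invmx (vec_mx_of s q) *m cov_mx_of s q else w q.
have w'U q : U q -> w' q = invmx (vec_mx_of s q) *m cov_mx_of s q.
  by move=> Uq; rewrite /w'; case: asboolP.
have w'w q : ~ Msing q -> w' q = w q.
  rewrite /w'; case: asboolP => // -[Vq Xq] rq.
  by rewrite AXw// mulmxA mulVmx// mul1mx.
exists U, w'; split=> //; split=> [q|c ca i j].
  have [Uq|nU] := pselect (U q).
    move=> _; rewrite w'U// /is_skew trmx_mul.
    (* Isotropy reads [A X^T = - X A^T]; multiplying by the inverses of [X] and [X^T] gives skewness
       of [X^-1 A]. *)
    have [Vq Xq] := Uq; move: (XA q Vq) => /eqP; rewrite addrC addr_eq0 => /eqP AX.
    set X := vec_mx_of s q in Xq AX *; set A := cov_mx_of s q in AX *.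
    have XTu : X^T \in unitmx by rewrite unitmx_tr.
    rewrite trmx_inv -[LHS](mulKmx Xq) -mulmxN; congr (_ *m _).
    rewrite mulmxA -[X *m A^T]opprK -AX mulNmx -mulmxA mulmxV// mulmx1//.
  by case=> // rq; rewrite w'w//; case: w_form => + _; exact.
apply: smooth_on_local => _ [q [Wq cq] <-].
have [Uq|nU] := pselect (U q).
  exists (cmap c @` (U `&` cdom c)); split; first by exists q.
  have oUc : open (cmap c @` (U `&` cdom c)) by exact: open_cmap_image.
  apply: (@eq_smooth_on _ _ _ oUc
    (fun x => (invmx (vec_mx_in s c x) *m cov_mx_in s c x) i j)).
    move=> _ /set_mem[p [Up cp] <-]; congr (fun_of_matrix _ i j).
    have [Vp Xp] := Up; rewrite form2_inE// w'U// vec_mx_inE// cov_mx_inE//.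
    set X := vec_mx_of s p in Xp *.
    (* This identifies the inverse of the vector matrix in [c], so that the quotient of the two
       chart matrices is [w'] in the coordinates of [c]. *)
    have FX : frame c p *m invmx X *m (X *m (coframe c p)^T) = 1%:M.
      by rewrite mulmxA mulmxKV// frameK.
    have [_ Yu] := mulmx1_unit FX.
    rewrite -[invmx _]mul1mx -FX mulmxK//.
    by rewrite !mulmxA.
  have sub : cmap c @` (U `&` cdom c) `<=` cmap c @` (V `&` cdom c).
    by move=> _ [p [[Vp _] cp] <-]; exists p.
  apply: smooth_on_mulmx => // {}i {}j; last first.
    by apply: smooth_on_sub sub _; case: (smooth_section_in i j ca ss).
  apply: smooth_on_invmx => // [_ [p [[Vp Xp] cp] <-]|{}i {}j].
    by rewrite unitmx_vec_mx_in.
  by apply: smooth_on_sub sub _; case: (smooth_section_in i j ca ss).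
have rq : ~ Msing q by case: Wq.
exists (cmap c @` (~` Msing `&` cdom c)); split; first by exists q.
have oc : open (cmap c @` (~` Msing `&` cdom c)) by exact: open_cmap_image.
have [_ /(_ c ca i j)] := w_form; apply: eq_smooth_on => // _ /set_mem[p [rp cp] <-].
by rewrite !form2_inE// w'w.
Qed.

Lemma form2_in_blows_up c (C : R) : atlas c -> cdom c m -> vec_mx_of s m \notin unitmx ->
  \forall p \near m, cdom c p /\
    (~ Msing p -> exists i j, C < `|form2_in c w (cmap c p) i j|).
Proof.
move=> ca cm Xm; have [ss fs _ AXw] := sV.
have oVc : open (cmap c @` (V `&` cdom c)) by exact: open_cmap_image.
have Vx : (cmap c @` (V `&` cdom c)) (cmap c m) by exists m.
have blow := @quotient_blows_up R n (vec_mx_in s c) (cov_mx_in s c) (form2_in c w) (cmap c m)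
  (fun x => ~ Msing (cinv c x)).
have {}blow : \forall x \near cmap c m, ~ Msing (cinv c x) ->
    exists i j, C < `|form2_in c w x i j|.
  apply: blow.
  - move=> i j; apply: smooth_on_continuous Vx.
    by case: (smooth_section_in i j ca ss).
  - move=> i j; apply: smooth_on_continuous Vx.
    by case: (smooth_section_in i j ca ss).
  - exact/row_free_in/fs.
  - by rewrite unitmx_vec_mx_in.
  - have := open_nbhs_nbhs (conj oVc Vx); apply: filterS => _ [q [Vq cq] <-].
    rewrite cmapK// => rq; rewrite form2_inE// vec_mx_inE// cov_mx_inE// AXw//.
    by rewrite !mulmxA -[_ *m _ *m frame c q]mulmxA coframeK// mulmx1.
apply: filterS (near_cmap cm blow) => p [cp]; rewrite cmapK//.
Qed.

End Frame.

(** An invertible [X] at [m] would yield a smooth extension, which the singularity rules out. *)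
Lemma singular_blow_up m c (C : R) : has_singularity Msing w m -> removable Msing w m ->
  atlas c -> cdom c m ->
  \forall p \near m, cdom c p /\
    (~ Msing p -> exists i j, C < `|form2_in c w (cmap c p) i j|).
Proof.
move=> [_ noext] /removable_frame[V [s [oV Vm sV]]] ca cm.
apply: (form2_in_blows_up oV Vm sV C ca cm); apply/negP => Xm.
exact/noext/(form2_extension oV Vm sV Xm).
Qed.

Lemma inv_norm_exp_cvg0 m g : smooth_metric g -> has_singularity Msing w m ->
  removable Msing w m -> forall e : R, 0 < e ->
  \forall p \near m, ~ Msing p -> inv_norm_exp w g p < e.
Proof.
move=> g_metric sing rem e e0.
have ca := chart_at_atlas m; have cm := chart_at_dom m; set c := chart_at m in ca cm.
have [d d0 low] := metric_norm_lower_bound ca cm g_metric.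
(* A coefficient above [(d * e)^-1] makes the norm of the exponential exceed [e^-1], by the lower
   bound with constant [d]. *)
have blow := singular_blow_up (d * e)^-1 sing rem ca cm.
apply: filterS2 low blow => p [cp low] [_ blow] rp.
have [i [j Cij]] := blow rp; have [skw _] := w_form.
have f0 := inv_norm_exp_gt0 g_metric w p.
rewrite -ltf_pV2 ?posrE// /inv_norm_exp invrK.
rewrite (ext_exp_form2_pull ca cp); last exact: skw.
set B := form2_in c w (cmap c p) in Cij *.
have skB : is_skew B by apply: form2_in_skew => //; exact: skw.
have BT k l : B l k = - B k l by move/matrixP: skB => /(_ k l); rewrite !mxE.
(* The coefficients of the exponential are matched with entries above the diagonal. Skewness moves a
   large entry there, and a diagonal entry is 0, so it cannot exceed the nonnegative threshold. *)
have [k [l [kl BE]]] : exists k l : 'I_n, (k < l)%N /\ `|B i j| = `|B k l|.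
  case: (ltngtP i j) => [ij|ji|/val_inj ij].
  - by exists i, j.
  - by exists j, i; rewrite BT normrN.
  - move: Cij; have /eqP := BT i i; rewrite -addr_eq0 -mulr2n mulrn_eq0 /= => /eqP B0.
    by rewrite -ij B0 normr0 ltNge invr_ge0 mulr_ge0// ltW.
apply: lt_le_trans (low (ext_exp (- ext_form2 B)) [set k; l]%SET).
by rewrite ext_exp_form2_2// normrN -BE -ltr_pdivrMl// -invfM.
Qed.

Lemma not_bounded m : has_singularity Msing w m -> removable Msing w m ->
  ~ bounded_singularity Msing w m.
Proof.
move=> sing rem [N [Nn [U [C [oU Um bdd]]]]].
have ca := chart_at_atlas m; have cm := chart_at_dom m; set c := chart_at m in ca cm.
have [d d0 low] := form2_norm_lower_bound ca cm Nn.
have blow := singular_blow_up (C / d) sing rem ca cm.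
(* Near [m], a regular point would have an entry of [w] above [C / d], hence norm above [C]. All
   nearby points would thus be singular, against density. *)
have : nbhs m Msing.
  apply: filterS3 low blow (open_nbhs_nbhs (conj oU Um)) => p [cp low] [_ blow] Up.
  apply: contrapT => rp; have [i [j Cij]] := blow rp; have [skw _] := w_form.
  have skB : is_skew (form2_in c w (cmap c p)) by apply: form2_in_skew => //; exact: skw.
  have := le_trans (low _ skB i j); rewrite form2_inK// => /(_ _ (bdd p Up rp)).
  by rewrite leNgt mulrC -ltr_pdivrMr// Cij.
rewrite nbhsE => -[B [oB Bm] BM].
have [q [Bq rq]] : B `&` ~` Msing !=set0 by apply: Msing_codense => //; exists m.
exact/rq/BM.
Qed.

End Removable.

Theorem corollary2p11 (R : realType) (n : nat) (hn : (2 <= n)%N)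
    (M : smooth_manifold R n)
    (Msing : set M) (Msing_closed : closed Msing)
    (Msing_codense : dense (~` Msing))
    (w : M -> 'M[R]_n) (w_form : is_form2 (~` Msing) w)
    (w_closed : closed_form2 (~` Msing) w)
    (g : M -> {ffun {set 'I_n} -> R} -> {ffun {set 'I_n} -> R} -> R)
    (g_metric : smooth_metric g) :
  let f := inv_norm_exp w g in
  smooth_fun (~` Msing) f /\
  forall m : M, has_singularity Msing w m ->
    (~ exists h, continuous_extension Msing f m h) \/
    (exists h, continuous_extension Msing f m h /\ h m <> 0) \/
    bounded_singularity Msing w m ->
    ~ removable Msing w m.
Proof.
have oreg : open (~` Msing) by exact: closed_openC.
move=> f; have sf : smooth_fun (~` Msing) f by exact: smooth_inv_norm_exp.
split=> // m sing obs rem.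
(* This limit along the regular set settles the first two obstructions: extension by 0 is
   continuous, and any continuous extension takes the value 0 at [m]. *)
have f0 : f @ within (~` Msing) (nbhs m) --> (0 : R).
  apply/cvgr0Pnorm_lt => e e0.
  have := inv_norm_exp_cvg0 Msing_closed Msing_codense w_form g_metric sing rem e0.
  by apply: filterS => p fp rp; rewrite gtr0_norm ?fp// inv_norm_exp_gt0.
have [Sm _] := sing.
case: obs => [noext|[[h [[hf hc] hm]]|bdd]].
- have [h hr hm] : exists2 h : M -> R, (forall p, ~ Msing p -> h p = f p) & h m = 0.
    (* Only the value at [m] is prescribed: continuity is tested within the regular set together
       with [m], so other singular points do not matter. *)
    exists (fun p => if p == m then 0 else f p); last by rewrite eqxx.
    by move=> p rp; case: eqP => // pm; rewrite pm in rp.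
  apply: noext; exists h; split=> //.
  apply/subspace_continuousP => p [rp|->].
    have fc : {for p, continuous f} by exact: smooth_fun_continuous rp.
    move=> A; rewrite /from_subspace hr// => /fc.
    apply: (@filterS2 _ (nbhs p)) (open_nbhs_nbhs (conj oreg rp)) => q rq Aq _.
    by rewrite /= hr.
  rewrite /from_subspace hm => A A0; have := f0 A A0; have A00 := nbhs_singleton A0.
  by apply: (@filterS _ (nbhs m)) => q Aq [rq|->]; rewrite /= ?hm// hr//; exact: Aq.
- apply: hm; have /subspace_continuousP/(_ m (or_intror erefl)) hcm := hc.
  (* Density makes approach to [m] through regular points a proper filter, which is what uniqueness
     of the limit requires. *)
  have PF : ProperFilter (within (~` Msing) (nbhs m)).
    apply: Build_ProperFilter_ex => P; rewrite /within /= nbhsE => -[B [oB Bm] BP].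
    have [q [Bq rq]] : B `&` ~` Msing !=set0 by apply: Msing_codense => //; exists m.
    by exists q; exact: BP.
  apply: (@cvg_unique _ (@Rhausdorff R) (f @ within (~` Msing) (nbhs m))) => // A /hcm.
  by apply: (@filterS _ (nbhs m)) => q Aq rq; rewrite /= -hf//; apply: Aq; left.
- exact: (not_bounded Msing_closed Msing_codense w_form sing rem).
Qed.
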